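(* Let $H$ be a probability measure supported in $[0,1)$ and assume that $a>0$. For any two Markov processes $(X_t)_{t\geq 0}$ and $(Y_t)_{t\geq 0}$ on $[0,\infty)$ with infinitesimal generator $$L_a(f)(x)=f'(x)+(x+a)\int_0^1 (f(hx)-f(x))\,H(dh),$$ with finite first moment at initial time, and for any $t>0$, we have $$W_1(\mathcal{L}(X_t),\mathcal{L}(Y_t))\leq e^{-a\kappa_1 t}\,W_1(\mathcal{L}(X_0),\mathcal{L}(Y_0)),$$ where $\kappa_1=1-\int_0^1 h\,H(dh)$. In particular, when $Y_0$ follows the invariant law $\mu$ of the dynamics generated by $L_a$, we get for every $t\geq 0$ $$W_1(\mathcal{L}(X_t),\mu)\leq e^{-a\kappa_1 t}\,W_1(\mathcal{L}(X_0),\mu).$$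
   Context: A process generated by $L_a$ is the piecewise deterministic Markov process on $[0,\infty)$ that increases linearly with slope $1$ between jumps, jumps at rate $x+a$ when at position $x$, and at each jump is multiplied by an independent random factor of law $H$. The process admits a unique invariant probability measure $\mu$. $\mathcal{L}(Z)$ denotes the law of $Z$, and $W_1(\alpha,\beta)=\inf_\Pi\int_{\mathbb{R}^2}|x-y|\,\Pi(dx,dy)$ (infimum over all laws $\Pi$ on $\mathbb{R}^2$ with marginals $\alpha$ and $\beta$) is the Wasserstein distance of order 1. *)

(* Defs.v *)
From HB Require Import structures.
From mathcomp Require Import all_boot all_order all_algebra.
From mathcomp Require Import all_classical all_reals all_analysis.
Set Implicit Arguments.
Unset Strict Implicit.
Unset Printing Implicit Defensive.
Import Order.TTheory GRing.Theory Num.Theory.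
Import numFieldNormedType.Exports.

Local Open Scope ring_scope.
Local Open Scope classical_set_scope.

Definition coupling (R : realType)
    (alpha beta : probability R R)
    (Pi : probability (R * R)%type R) : Prop :=
  (forall A : set R, measurable A -> Pi (fst @^-1` A) = alpha A) /\
  (forall A : set R, measurable A -> Pi (snd @^-1` A) = beta A).

Definition W1 (R : realType)
    (alpha beta : probability R R) : \bar R :=
  ereal_inf [set (\int[Pi]_z (`|z.1 - z.2|%:E))%E | Pi in coupling alpha beta].

Definition La (R : realType) (H : probability R R) (a : R)
    (f : R -> R) (x : R) : R :=
  derive1 f x + (x + a) * \int[H]_(h in `[0, 1]) (f (h * x) - f x).

Definition kappa1 (R : realType) (H : probability R R) : R :=
  1 - \int[H]_(h in `[0, 1]) h.

(** Bounded C^1 functions with bounded derivative.  Every such function on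
    [0, +oo[ (with a one-sided derivative at 0) is the restriction of one
    defined on the whole line, and [La H a f] on [0, +oo[ depends only on that
    restriction. *)
Definition C1b (R : realType) (f : R -> R) : Prop :=
  [/\ forall x : R, derivable f x 1,
      continuous (derive1 f),
      exists M : R, forall x, `|f x| <= M
    & exists M : R, forall x, `|derive1 f x| <= M].

(** Laws on [0, +oo[ are encoded as laws on the line that give mass 1 to
    [0, +oo[; accordingly, nothing is required of [P t x] when [t < 0] or
    [x < 0]. *)
Definition markov_semigroup (R : realType)
    (P : R -> R.-pker R ~> R) : Prop :=
  [/\ forall t x : R, 0 <= t -> 0 <= x -> P t x `[0, +oo[ = 1%E,
      forall (x : R) (B : set R), 0 <= x -> measurable B -> P 0 x B = \d_x B
    & forall (s t x : R) (B : set R), 0 <= s -> 0 <= t -> 0 <= x -> measurable B ->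
        P (s + t) x B = (\int[P s x]_y P t y B)%E].

(** [G] is the infinitesimal generator of [P] on the class [D]: it is the
    derivative at 0 of the semigroup, and Dynkin's formula holds.  As [G f] may
    be unbounded for bounded [f], the formula is not a formal consequence of the
    pointwise limit, and the integrability it presupposes is spelled out. *)
Definition generator (R : realType)
    (P : R -> R.-pker R ~> R)
    (D : (R -> R) -> Prop) (G : (R -> R) -> R -> R) : Prop :=
  forall f, D f -> forall x : R, 0 <= x ->
  [/\ (\int[P t x]_y f y - f x) / t @[t --> 0^'+] --> G f x,
      forall t : R, 0 <= t -> (P t x).-integrable setT (EFin \o G f)
    & forall t : R, 0 <= t ->
        lebesgue_measure.-integrable `[0, t]
          (fun s : R => (\int[P s x]_y G f y)%:E) /\
        \int[P t x]_y f y =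
          f x + \int[lebesgue_measure]_(s in `[0, t]) (\int[P s x]_y G f y)].

Definition past (R : realType) (d : measure_display) (T : measurableType d)
    (Pr : probability T R) (X : R -> {RV Pr >-> R}) (s : R) : set (set T) :=
  <<s [set A | exists (r : R) (B : set R),
         [/\ 0 <= r, r <= s, measurable B & A = X r @^-1` B] ]>>.

(** The time index ranges over [0, +oo[; [X t] is irrelevant for [t < 0]. *)
Definition markov_process (R : realType) (d : measure_display)
    (T : measurableType d) (Pr : probability T R) (X : R -> {RV Pr >-> R})
    (P : R -> R.-pker R ~> R) : Prop :=
  (forall (t : R) (w : T), 0 <= t -> 0 <= X t w) /\
  (forall (s t : R) (A : set T) (B : set R), 0 <= s -> s <= t ->
     past X s A -> measurable B ->
     Pr (A `&` X t @^-1` B) = (\int[Pr]_(w in A) P (t - s)%R (X s w) B)%E).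

Definition semigroup_La (R : realType) (H : probability R R)
    (a : R) (P : R -> R.-pker R ~> R) :=
  markov_semigroup P /\ generator P (@C1b R) (La H a).

Definition process_La (R : realType) (H : probability R R)
    (a : R) (d : measure_display) (T : measurableType d) (Pr : probability T R)
    (X : R -> {RV Pr >-> R}) : Prop :=
  exists2 P, semigroup_La H a P & markov_process X P.

Definition invariant_La (R : realType) (H : probability R R)
    (a : R) (mu : probability R R) : Prop :=
  mu `[0, +oo[ = 1%E /\
  exists2 P, semigroup_La H a P &
    forall (t : R) (B : set R), 0 <= t -> measurable B ->
      (\int[mu]_x P t x B)%E = mu B.

(* Main.v *)
Require Import Defs.
From HB Require Import structures.
From mathcomp Require Import all_boot all_order all_algebra.
From mathcomp Require Import all_classical all_reals all_analysis.
From mathcomp Require Import measurable_realfun ring lra.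
Set Implicit Arguments.
Unset Strict Implicit.
Unset Printing Implicit Defensive.
Import Order.TTheory GRing.Theory Num.Theory.
Import numFieldNormedType.Exports.
Local Open Scope ring_scope.
Local Open Scope classical_set_scope.

(** Let [P], [Q] be two semigroups with generator [La] and let [J] be the jump
    part of [La].  Testing Dynkin's formula against bounded approximations of
    [exp (l x)] with [l -> oo] shows that [P t x] lives on [0, x + 3 t], so that
    all coefficients are bounded along the way.  If [f] is 1-Lipschitz with
    Lipschitz derivative, cutting [0, e] into [n] pieces and transporting [f]
    along the drift on each of them gives, in the limit [n -> oo],
    [P e f x = f (x + e) + e * J f x + O(e ^ 2)], where the error does not depend
    on the Lipschitz constant of [f'].  As [a > 0], the main term contracts
    Lipschitz constants by the factor [exp (- a kappa1 e)], so that
    [|P e f x - Q e f y| <= exp (- a kappa1 e) * |x - y| + O(e ^ 2)].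

    On the line, the supremum of [m f - p f] over such [f] is the L1 distance of
    the tails [s |-> m [s, +oo[], which dominates [W1] thanks to the quantile
    coupling.  Integrating the short time estimate against couplings, iterating
    it [n] times with [e = t / n] and letting [n -> oo], the errors add up to
    [O(1 / n)], which gives the contraction between starting points and then,
    integrating once more, between arbitrary initial laws.  Uniqueness of the
    semigroup is never needed. *)

(** * Expectations of laws carried by a set *)

(** The usual argument couples two copies of the process through a generator on pairs. That
    presupposes a coupled process, whereas here only one-dimensional semigroups are given, each
    known through its action on [C1b]. The coupling is therefore performed infinitesimally, in the
    algebra of the expansion of [P e f], and never on paths.

    Two obstacles shape the estimates. The jump rate is unbounded, so [La H a f] may grow at
    infinity even for bounded [f], and no expansion is uniform before the support is controlled.
    Moreover the dual functions that matter have derivatives close to the sign of a difference of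
    tails, hence with arbitrarily large Lipschitz constants: an error depending on this constant
    would be infinite after taking the supremum over [f], which happens at every time step.

    The constant 3 in the support bound is deliberately crude, the true upward speed being 1. The
    bootstrap that replaces Gronwall's lemma costs a factor [exp (2 l t)] instead of [exp (l t)],
    and one more [l t] is kept in reserve so that the bound tends to 0 as [l] grows. *)

Section integrable_real.
Context (R : realType) d (T : measurableType d).
Context (mu : {measure set T -> \bar R}).
Implicit Types (f g : T -> R) (c : R).

Lemma integrable_realB (D : set T) f g :
  measurable D -> mu.-integrable D (EFin \o f) -> mu.-integrable D (EFin \o g) ->
  mu.-integrable D (EFin \o (fun y => f y - g y)).
Proof.
move=> mD fi gi.
have -> : EFin \o (fun y => f y - g y) = ((EFin \o f) \- (EFin \o g))%E.
  by apply/funext => y /=; rewrite EFinB.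
exact: integrableB.
Qed.

Lemma integrable_realD (D : set T) f g :
  measurable D -> mu.-integrable D (EFin \o f) -> mu.-integrable D (EFin \o g) ->
  mu.-integrable D (EFin \o (fun y => f y + g y)).
Proof.
move=> mD fi gi.
have -> : EFin \o (fun y => f y + g y) = ((EFin \o f) \+ (EFin \o g))%E.
  by apply/funext => y /=; rewrite EFinD.
exact: integrableD.
Qed.

Lemma integrable_realZ (D : set T) f c :
  measurable D -> mu.-integrable D (EFin \o f) ->
  mu.-integrable D (EFin \o (fun y => c * f y)).
Proof.
move=> mD fi.
have -> : EFin \o (fun y => c * f y) = (fun y => c%:E * (EFin \o f) y)%E.
  by apply/funext => y /=; rewrite EFinM.
exact: integrableZl.
Qed.

Lemma integrable_real_norm (D : set T) f :
  measurable D -> mu.-integrable D (EFin \o f) ->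
  mu.-integrable D (EFin \o (fun y => `|f y|)).
Proof.
move=> mD fi.
have -> : EFin \o (fun y => `|f y|) = (abse \o (EFin \o f))%E.
  by apply/funext => y /=.
exact: integrable_abse.
Qed.

End integrable_real.

(** Asks for a bare measure, with the total mass as a conjunct, so that it applies to the values
    [P t x] of a kernel as well as to bundled probabilities. *)
Definition carried_by (R : realType) (m : {measure set R -> \bar R})
    (A : set R) : Prop :=
  [/\ measurable A, m [set: R] = 1%E & m A = 1%E].

Section expectation_on_support.
Context (R : realType).
Implicit Types (m : {measure set R -> \bar R}) (A : set R) (f g : R -> R).

Lemma carried_by_setC m A : carried_by m A -> m (~` A) = 0%E.
Proof.
move=> [mA m1 mA1].
have : (m A + m (~` A) = 1)%E.
  by rewrite -measureU ?setUv ?m1//; [exact: measurableC|exact: setICr].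
rewrite mA1; case: (m (~` A)) => [r|//|//] [] r0.
by congr (_%:E); lra.
Qed.

Lemma carried_by_sub m A B :
  carried_by m A -> measurable B -> A `<=` B -> carried_by m B.
Proof.
move=> [mA m1 mA1] mB AB; split => //; apply/le_anti/andP; split.
  by rewrite -m1; apply: le_measure; rewrite ?inE.
by rewrite -mA1; apply: le_measure; rewrite ?inE.
Qed.

Lemma carried_by_le1 m A B : carried_by m A -> measurable B -> (m B <= 1)%E.
Proof. by move=> [_ <- _] mB; apply: le_measure; rewrite ?inE. Qed.

Lemma carried_by_fin_num m A B :
  carried_by m A -> measurable B -> m B \is a fin_num.
Proof.
move=> cA mB; rewrite ge0_fin_numE//.
by apply: le_lt_trans (carried_by_le1 cA mB) _; rewrite ltry.
Qed.

(** A bound on the support suffices; unbounded integrands such as [jump f] become integrable once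
    the law lives on a compact interval. *)
Lemma integrable_carried m A g M :
  carried_by m A ->
  measurable_fun [set: R] g -> (forall y, A y -> `|g y| <= M) ->
  m.-integrable [set: R] (EFin \o g).
Proof.
move=> cA mg gM; have [mA m1 mA1] := cA.
apply/(@negligible_integrable _ _ _ m _ (~` A)) => //.
- exact: measurableC.
- exact/measurable_EFinP.
- exact: carried_by_setC.
rewrite setDE setCK setTI; apply: measurable_bounded_integrable => //.
- by rewrite mA1 ltry.
- exact: measurable_funS mg.
exists M; split; first exact: num_real.
by move=> z Mz y Ay; apply: le_trans (gM _ Ay) (ltW Mz).
Qed.

Lemma Rintegral_carried m A g :
  carried_by m A -> m.-integrable [set: R] (EFin \o g) ->
  \int[m]_y g y = \int[m]_(y in A) g y.
Proof.
move=> cA ig; have [mA _ _] := cA.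
rewrite /Rintegral (@negligible_integral _ _ _ m _ (~` A))//.
- by rewrite setDE setCK setTI.
- exact: measurableC.
- exact: carried_by_setC.
Qed.

Lemma le_Rintegral_carried m A f g :
  carried_by m A -> m.-integrable [set: R] (EFin \o f) ->
  m.-integrable [set: R] (EFin \o g) -> (forall y, A y -> f y <= g y) ->
  \int[m]_y f y <= \int[m]_y g y.
Proof.
move=> cA fi gi fg; have [mA _ _] := cA.
rewrite !(Rintegral_carried cA)//; apply: le_Rintegral => //.
- exact: integrableS fi.
- exact: integrableS gi.
Qed.

Lemma Rintegral_carried_cst m A (c : R) : carried_by m A -> \int[m]_y c = c.
Proof. by move=> [_ m1 _]; rewrite Rintegral_cst// m1 mulr1. Qed.

Lemma integrable_carried_cst m A (c : R) :
  carried_by m A -> m.-integrable [set: R] (EFin \o cst c).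
Proof. by move=> cA; apply: (integrable_carried (M := `|c|) cA). Qed.

Lemma Rintegral_carried_close m A f g (e : R) :
  carried_by m A -> m.-integrable [set: R] (EFin \o f) ->
  m.-integrable [set: R] (EFin \o g) ->
  (forall y, A y -> `|f y - g y| <= e) ->
  `|\int[m]_y f y - \int[m]_y g y| <= e.
Proof.
move=> cA fi gi fge.
rewrite -RintegralB//; apply: le_trans (le_normr_Rintegral _ _) _ => //.
  by apply: integrable_realB.
rewrite -[leRHS](Rintegral_carried_cst e cA).
apply: (le_Rintegral_carried cA) => //.
  by apply: integrable_real_norm => //; apply: integrable_realB.
exact: integrable_carried_cst cA.
Qed.

Lemma Rintegral_carried_bound m A f (e c : R) :
  carried_by m A -> m.-integrable [set: R] (EFin \o f) ->
  (forall y, A y -> `|f y - c| <= e) ->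
  `|\int[m]_y f y - c| <= e.
Proof.
move=> cA fi fge; rewrite -{1}(Rintegral_carried_cst c cA).
by apply: (Rintegral_carried_close cA) => //; exact: integrable_carried_cst cA.
Qed.

End expectation_on_support.

(** * Lipschitz functions and their average over the jump factor *)

Definition lipschitz_with (R : realType) (l : R) (f : R -> R) : Prop :=
  forall y z, `|f y - f z| <= l * `|y - z|.

Section lipschitz_functions.
Context (R : realType).
Implicit Types (f : R -> R) (l : R).

Lemma lipschitz_with_ge0 l f : lipschitz_with l f -> 0 <= l.
Proof. by move=> /(_ 1 0); rewrite subr0 normr1 mulr1; apply: le_trans. Qed.

Lemma lipschitz_with_continuous l f : lipschitz_with l f -> continuous f.
Proof.
move=> fl x; have l0 := lipschitz_with_ge0 fl.
apply/cvgrPdist_le => e e0; near=> y.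
apply: le_trans (fl _ _) _; apply: (@le_trans _ _ ((l + 1) * `|x - y|)).
  by rewrite ler_wpM2r//; lra.
rewrite mulrC -ler_pdivlMr; last lra.
near: y; apply: cvgr_dist_le; first exact: cvg_id.
by rewrite divr_gt0//; lra.
Unshelve. all: by end_near. Qed.

Lemma lipschitz_with_measurable l f :
  lipschitz_with l f -> measurable_fun [set: R] f.
Proof.
by move=> fl; apply: continuous_measurable_fun; exact: lipschitz_with_continuous fl.
Qed.

End lipschitz_functions.

Section jump_average.
Context (R : realType) (H : probability R R).
Hypothesis H01 : H `[0, 1[%classic = 1%E.
Implicit Types (f : R -> R) (l x y z : R).

Definition average f x : R := \int[H]_(h in `[0, 1]) f (h * x).

Lemma carried_by_01 : carried_by H `[0, 1].
Proof.
apply: (@carried_by_sub _ _ `[0, 1[%classic) => //.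
  by split => //; exact: probability_setT.
by apply: subset_itvl; rewrite bnd_simp.
Qed.

Lemma integrable_01 (g : R -> R) (M : R) : measurable_fun [set: R] g ->
  (forall h, 0 <= h <= 1 -> `|g h| <= M) ->
  H.-integrable `[0, 1] (EFin \o g).
Proof.
move=> mg gM; apply: (integrableS (E := [set: R])) => //.
by apply: (integrable_carried (M := M) carried_by_01).
Qed.

Lemma integrable_01_scale l f x : lipschitz_with l f ->
  H.-integrable `[0, 1] (EFin \o (fun h => f (h * x))).
Proof.
move=> fl; apply: (@integrable_01 _ (`|f 0| + l * `|x|)).
  apply: (measurableT_comp (lipschitz_with_measurable fl)).
  exact: measurable_funM.
move=> h /andP[h0 h1].
rewrite -[f (h * x)](subrK (f 0)) addrC; apply: le_trans (ler_normD _ _) _.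
rewrite lerD2l (le_trans (fl _ _))// subr0 ler_wpM2l ?(lipschitz_with_ge0 fl)//.
by rewrite normrM (ger0_norm h0) ler_piMl.
Qed.

Lemma integrable_01_id : H.-integrable `[0, 1] (EFin \o id).
Proof.
by apply: (@integrable_01 _ 1) => // h /andP[h0 h1]; rewrite ger0_norm.
Qed.

Lemma integrable_01_cst x : H.-integrable `[0, 1] (EFin \o cst x).
Proof. exact: (@integrable_01 _ `|x|). Qed.

Lemma Rintegral_01_cst x : \int[H]_(h in `[0, 1]) x = x.
Proof.
by rewrite Rintegral_cst//; have [_ _ ->] := carried_by_01; rewrite mulr1.
Qed.

Lemma kappa1_ge0 : 0 <= kappa1 H.
Proof.
rewrite subr_ge0 -[leRHS]Rintegral_01_cst; apply: le_Rintegral => //.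
- exact: integrable_01_id.
- exact: integrable_01_cst.
- by move=> h /=; rewrite in_itv/= => /andP[].
Qed.

Lemma kappa1_le1 : kappa1 H <= 1.
Proof.
rewrite gerBl; apply: Rintegral_ge0 => h /=.
by rewrite in_itv/= => /andP[].
Qed.

(** A common factor [h] shrinks [|y - z|] to [h * |y - z|], and the mean of [h] is
    [1 - kappa1 H]. *)
Lemma average_dist l f y z : lipschitz_with l f ->
  `|average f y - average f z| <= l * (1 - kappa1 H) * `|y - z|.
Proof.
move=> fl; rewrite -RintegralB//; [|exact: integrable_01_scale fl..].
apply: le_trans (le_normr_Rintegral _ _) _ => //.
  by apply: integrable_realB => //; exact: integrable_01_scale fl.
rewrite opprB addrC subrK.
rewrite [leRHS](_ : _ = \int[H]_(h in `[0, 1]) ((l * `|y - z|) * h)); last first.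
  by rewrite RintegralZl//; [ring|exact: integrable_01_id].
apply: le_Rintegral => //.
- apply: integrable_real_norm => //; apply: integrable_realB => //;
    exact: integrable_01_scale fl.
- by apply: integrable_realZ => //; exact: integrable_01_id.
move=> h /=; rewrite in_itv/= => /andP[h0 h1].
apply: le_trans (fl _ _) _.
by rewrite -mulrBr normrM (ger0_norm h0) -mulrA [h * _]mulrC.
Qed.

(** A jump from [y] covers the distance [(1 - h) * |y|], of mean [kappa1 H * |y|]. *)
Lemma average_self l f y : lipschitz_with l f ->
  `|average f y - f y| <= l * kappa1 H * `|y|.
Proof.
move=> fl; rewrite -[X in _ - X]Rintegral_01_cst -RintegralB//; last 2 first.
  exact: integrable_01_scale fl.
  exact: integrable_01_cst.
have i1 : H.-integrable `[0, 1] (EFin \o (fun h => f (h * y) - f y)).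
  apply: integrable_realB => //; first exact: integrable_01_scale fl.
  exact: integrable_01_cst.
apply: le_trans (le_normr_Rintegral _ _) _ => //.
have i2 : H.-integrable `[0, 1] (EFin \o (fun h => 1 - h)).
  apply: integrable_realB => //; first exact: integrable_01_cst.
  exact: integrable_01_id.
rewrite [leRHS](_ : _ = \int[H]_(h in `[0, 1]) ((l * `|y|) * (1 - h))); last first.
  rewrite RintegralZl// RintegralB ?Rintegral_01_cst//; first by rewrite /kappa1; ring.
  exact: integrable_01_cst.
  exact: integrable_01_id.
apply: le_Rintegral => //.
- exact: integrable_real_norm.
- exact: integrable_realZ.
move=> h /=; rewrite in_itv/= => /andP[h0 h1].
apply: le_trans (fl _ _) _.
rewrite distrC -{1}[y]mul1r -mulrBl normrM ger0_norm ?subr_ge0//.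
by rewrite -mulrA [_ * (1 - h)]mulrC.
Qed.

Lemma La_average a f x l : lipschitz_with l f ->
  La H a f x = derive1 f x + (x + a) * (average f x - f x).
Proof.
move=> fl; rewrite /La RintegralB ?Rintegral_01_cst//.
  exact: integrable_01_scale fl.
exact: integrable_01_cst.
Qed.

Lemma average_le f x l : lipschitz_with l f -> {homo f : y z / y <= z} ->
  0 <= x -> average f x <= f x.
Proof.
move=> fl fmon x0; rewrite -[leRHS]Rintegral_01_cst; apply: le_Rintegral => //.
- exact: integrable_01_scale fl.
- exact: integrable_01_cst.
move=> h /=; rewrite in_itv/= => /andP[h0 h1].
by apply: fmon; rewrite ler_piMl.
Qed.

End jump_average.

(** * Expectations under Markov kernels and their composition *)

Section kernel_expectation.
Context (R : realType).
Implicit Types (k l : R.-pker R ~> R) (f : R -> R) (M : R).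

Lemma carried_by_setT k x : carried_by (k x) [set: R].
Proof. by split => //; exact: prob_kernel. Qed.

Lemma integrable_kernel k x f M : measurable_fun [set: R] f ->
  (forall y, `|f y| <= M) -> (k x).-integrable [set: R] (EFin \o f).
Proof. by move=> mf fM; apply: (integrable_carried (carried_by_setT k x)). Qed.

Lemma ge0_integral_kernelE k x f M : measurable_fun [set: R] f ->
  (forall y, `|f y| <= M) ->
  (\int[k x]_y (f y)%:E)%E = (\int[k x]_y f y)%:E.
Proof.
move=> mf fM; rewrite fineK//; apply: integrable_fin_num => //.
exact: integrable_kernel fM.
Qed.

Lemma measurable_kernel_Rintegral k f M : measurable_fun [set: R] f ->
  (forall y, `|f y| <= M) ->
  measurable_fun [set: R] (fun x => \int[k x]_y f y).
Proof.
move=> mf fM.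
(* Adding [M] makes the integrand nonnegative, where measurability of kernel integrals requires no
   integrability. *)
have fM0 y : 0 <= f y + M by have := fM y; rewrite ler_norml => /andP[]; lra.
have -> : (fun x => \int[k x]_y f y) = (fun x => \int[k x]_y (f y + M) - M).
  apply/funext => x; rewrite RintegralD//; last 2 first.
    exact: integrable_kernel fM.
    exact: (integrable_carried_cst M (carried_by_setT k x)).
  by rewrite (Rintegral_carried_cst M (carried_by_setT k x)) addrK.
apply: measurable_funB => //.
apply: measurableT_comp => //.
apply: (@measurable_fun_integral_kernel _ _ R R R (fun x => k x)
  (fun U => measurable_kernel k U) (fun y => (f y + M)%:E)) => //.
apply/measurable_EFinP; exact: measurable_funD.
Qed.

Lemma Rintegral_kernel_le k x f M : measurable_fun [set: R] f ->
  (forall y, `|f y| <= M) -> `|\int[k x]_y f y| <= M.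
Proof.
move=> mf fM; rewrite -[X in `|X|]subr0.
apply: (Rintegral_carried_bound (carried_by_setT k x)).
  exact: integrable_kernel fM.
by move=> y _; rewrite subr0.
Qed.

Lemma integral_mixture (m' : {measure set R -> \bar R}) l x k (f : R -> \bar R) :
  (forall B : set R, measurable B -> m' B = (\int[l x]_y k y B)%E) ->
  measurable_fun [set: R] f -> (forall y, 0 <= f y)%E ->
  (\int[m']_y f y = \int[l x]_y \int[k y]_z f z)%E.
Proof.
move=> m'E mf f0.
(* [kernel.kernel_snd k] ignores the starting point, so composing it with [l] gives the usual
   product of Markov kernels. *)
rewrite -(integral_kcomp l (kernel.kernel_snd k))//.
by apply: eq_measure_integral => A mA _; rewrite m'E.
Qed.

Lemma Rintegral_mixture (m' : {measure set R -> \bar R}) l x k f M :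
  (forall B : set R, measurable B -> m' B = (\int[l x]_y k y B)%E) ->
  measurable_fun [set: R] f -> (forall y, `|f y| <= M) ->
  \int[m']_y f y = \int[l x]_y \int[k y]_z f z.
Proof.
move=> m'E mf fM.
have cm' : carried_by m' [set: R].
  split => //; rewrite m'E//.
    under eq_integral do rewrite prob_kernel.
    by rewrite integral_cst// mul1e prob_kernel.
  under eq_integral do rewrite prob_kernel.
  by rewrite integral_cst// mul1e prob_kernel.
have fM0 y : 0 <= f y + M by have := fM y; rewrite ler_norml => /andP[]; lra.
have mfM : measurable_fun [set: R] (fun y => f y + M) by exact: measurable_funD.
have fMM y : `|f y + M| <= M + M.
  by rewrite (le_trans (ler_normD _ _))// lerD// ger0_norm// (le_trans _ (fM 0)).
have shift (m : {measure set R -> \bar R}) : carried_by m [set: R] ->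
    \int[m]_y (f y + M) = \int[m]_y f y + M.
  move=> cm; rewrite RintegralD//; last 2 first.
    by apply: (integrable_carried (M := M) cm).
    exact: (integrable_carried_cst M cm).
  by rewrite (Rintegral_carried_cst M cm).
(* Both sides are shifted by [M] to reach the nonnegative case [integral_mixture]. *)
apply: (addIr M); rewrite -shift//.
rewrite /Rintegral (integral_mixture (m' := m') (l := l) (x := x) (k := k))//; last first.
  exact/measurable_EFinP.
rewrite -[RHS](_ : \int[l x]_y (\int[k y]_z f z + M) = _); last first.
  rewrite RintegralD//; last 2 first.
    apply: (@integrable_kernel _ _ _ M); first exact: measurable_kernel_Rintegral fM.
    by move=> y; exact: Rintegral_kernel_le.
    exact: (integrable_carried_cst M (carried_by_setT l x)).
  by rewrite (Rintegral_carried_cst M (carried_by_setT l x)).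
congr fine; apply: eq_integral => y _.
by rewrite (ge0_integral_kernelE _ _ mfM fMM) shift//; exact: carried_by_setT.
Qed.

End kernel_expectation.

(** * The semigroup does not charge [x + 3 t, +oo[ *)

Section derivable_functions.
Context (R : realType).
Implicit Types (f : R -> R) (l d x y z : R).

Lemma derivable_lipschitz_with f l : (forall x : R, derivable f x 1) ->
  (forall x, `|derive1 f x| <= l) -> lipschitz_with l f.
Proof.
move=> df f'l.
have l0 : 0 <= l by apply: le_trans (f'l 0).
have main y z : y <= z -> `|f z - f y| <= l * `|z - y|.
  move=> yz; have [x _ ->] : exists2 x, x \in `[y, z]%R &
      f z - f y = derive1 f x * (z - y).
    apply: MVT_segment => //.
      by move=> x _; rewrite derive1E; apply: derivableP.
    apply: continuous_subspaceT => x; apply: differentiable_continuous.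
    by apply/derivable1_diffP.
  by rewrite normrM ler_wpM2r.
move=> y z; have [yz|/ltW zy] := leP z y; first exact: main.
by rewrite distrC [`|y - z|]distrC; exact: main.
Qed.

(** This is [exp (l y) / (1 + d exp (l y))]: capped at [1 / d], hence in [C1b], and its logarithmic
    derivative is still at most [l], as for the exponential. *)
Definition logistic (l d y : R) : R := (expR (- (l * y)) + d)^-1.

Lemma logistic_gt0 l d y : 0 < d -> 0 < logistic l d y.
Proof. by move=> d0; rewrite invr_gt0 addr_gt0 ?expR_gt0. Qed.

Lemma logistic_le l d y : 0 < d -> logistic l d y <= d^-1.
Proof.
by move=> d0; rewrite lef_pV2 ?posrE ?addr_gt0 ?expR_gt0// lerDr expR_ge0.
Qed.

Lemma logistic_homo l d : 0 < l -> 0 < d -> {homo logistic l d : y z / y <= z}.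
Proof.
move=> l0 d0 y z yz; rewrite lef_pV2 ?posrE ?addr_gt0 ?expR_gt0//.
by rewrite lerD2r ler_expR lerN2 ler_pM2l.
Qed.

Lemma is_derive_logistic l d (y : R) : 0 < d ->
  is_derive y 1 (logistic l d) (l * expR (- (l * y)) * logistic l d y ^+ 2).
Proof.
move=> d0.
have p0 : expR (- (l * y)) + d != 0 by rewrite gt_eqF// addr_gt0 ?expR_gt0.
have dE : is_derive y 1 (fun x => expR (- (l * x)) + d) (- l * expR (- (l * y))).
  apply: is_derive_eq; rewrite /= ?scaler0 !addr0 ?add0r /GRing.scale/=.
  by ring.
have dV := @is_deriveV R (fun x => expR (- (l * x)) + d) y _ 1 p0 dE.
apply: (is_derive_eq dV).
by rewrite /logistic /GRing.scale/= -exprVn; ring.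
Qed.

Lemma derive1_logistic l d y : 0 < d ->
  derive1 (logistic l d) y = l * expR (- (l * y)) * logistic l d y ^+ 2.
Proof. by move=> d0; rewrite derive1E; have [_ ->] := is_derive_logistic l y d0. Qed.

Lemma continuous_logistic l d : 0 < d -> continuous (logistic l d).
Proof.
move=> d0 x; apply: differentiable_continuous; apply/derivable1_diffP.
by have [] := is_derive_logistic l x d0.
Qed.

Lemma derive1_logistic_le l d y : 0 < l -> 0 < d ->
  0 <= derive1 (logistic l d) y <= l * logistic l d y.
Proof.
move=> l0 d0; have g0 := logistic_gt0 l y d0.
rewrite derive1_logistic//; apply/andP; split.
  by rewrite !mulr_ge0 ?expR_ge0 ?sqr_ge0// ltW.
rewrite -mulrA ler_pM2l// expr2 mulrA ger_pMl//.
by rewrite ler_pdivrMr ?addr_gt0 ?expR_gt0// mul1r lerDl ltW.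
Qed.

Lemma derive1_logistic_bound l d y : 0 < l -> 0 < d ->
  `|derive1 (logistic l d) y| <= l * d^-1.
Proof.
move=> l0 d0; have /andP[g0 g1] := derive1_logistic_le y l0 d0.
by rewrite ger0_norm// (le_trans g1)// ler_pM2l// logistic_le.
Qed.

Lemma logistic_C1b l d : 0 < l -> 0 < d -> C1b (logistic l d).
Proof.
move=> l0 d0; split.
- by move=> x; have [] := is_derive_logistic l x d0.
- rewrite (_ : derive1 _ =
      fun y => l * expR (- (l * y)) * logistic l d y ^+ 2); last first.
    by apply/funext => y; rewrite derive1_logistic.
  move=> x; apply: cvgM.
    apply: cvgMr; apply: continuous_comp; last exact: continuous_expR.
    by apply: cvgN; apply: cvgMr; exact: cvg_id.
  rewrite expr2; under [X in X @ _]eq_fun do rewrite expr2.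
  by apply: cvgM; exact: continuous_logistic.
- exists d^-1 => x; rewrite ger0_norm ?logistic_le// ltW// logistic_gt0//.
- by exists (l * d^-1) => x; exact: derive1_logistic_bound.
Qed.

Lemma logistic_lipschitz l d : 0 < l -> 0 < d ->
  lipschitz_with (l * d^-1) (logistic l d).
Proof.
move=> l0 d0; apply: derivable_lipschitz_with.
- by move=> x; have [] := is_derive_logistic l x d0.
- by move=> x; exact: derive1_logistic_bound.
Qed.

End derivable_functions.

(** * Exponential moments and range of the semigroup *)

Section support.
Context (R : realType) (H : probability R R) (a : R) (P : R -> R.-pker R ~> R).
Hypothesis H01 : H `[0, 1[%classic = 1%E.
Hypothesis a_gt0 : 0 < a.
Hypothesis P_La : semigroup_La H a P.
Implicit Types (f : R -> R) (c e l d q r s t x y z : R).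

Lemma carried_by_ge0 t x : 0 <= t -> 0 <= x -> carried_by (P t x) `[0, +oo[.
Proof.
move=> t0 x0; split => //; first exact: prob_kernel.
by case: P_La => -[+ _ _] _; apply.
Qed.

Lemma integrable_La f t x : C1b f -> 0 <= t -> 0 <= x ->
  (P t x).-integrable [set: R] (EFin \o La H a f).
Proof. by move=> Cf t0 x0; case: P_La => _ /(_ f Cf x x0)[_ + _]; apply. Qed.

Lemma Rintegral_itv_cst c t : 0 <= t ->
  \int[lebesgue_measure]_(s in `[0, t]) c = c * t.
Proof.
move=> t0; rewrite Rintegral_cst//= lebesgue_measure_itv/= lte_fin.
by case: ltgtP t0 => // [_ _|<- _]; rewrite /= ?subr0 ?mulr0.
Qed.

Lemma integrable_itv_cst c t :
  lebesgue_measure.-integrable `[0, t] (EFin \o cst c).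
Proof.
apply: measurable_bounded_integrable => //.
  by rewrite /= lebesgue_measure_itv/=; case: ifP => _; rewrite ltry.
by exists `|c|; split => // M cM s _; exact: ltW.
Qed.

Lemma dynkin_le f c t x : C1b f -> 0 <= t -> 0 <= x ->
  (forall s, 0 <= s <= t -> \int[P s x]_y La H a f y <= c) ->
  \int[P t x]_y f y <= f x + c * t.
Proof.
move=> Cf t0 x0 Lc; case: P_La => _ /(_ f Cf x x0)[_ _ /(_ t t0)[it ->]].
rewrite lerD2l -(Rintegral_itv_cst _ t0); apply: le_Rintegral => //.
exact: integrable_itv_cst.
Qed.

Lemma dynkin_ge f c t x : C1b f -> 0 <= t -> 0 <= x ->
  (forall s, 0 <= s <= t -> c <= \int[P s x]_y La H a f y) ->
  f x + c * t <= \int[P t x]_y f y.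
Proof.
move=> Cf t0 x0 Lc; case: P_La => _ /(_ f Cf x x0)[_ _ /(_ t t0)[it ->]].
rewrite lerD2l -(Rintegral_itv_cst _ t0); apply: le_Rintegral => //.
exact: integrable_itv_cst.
Qed.

Lemma dynkin_close f c e t x : C1b f -> 0 <= t -> 0 <= x ->
  (forall s, 0 <= s <= t -> `|\int[P s x]_y La H a f y - c| <= e) ->
  `|\int[P t x]_y f y - (f x + c * t)| <= e * t.
Proof.
move=> Cf t0 x0 Le; rewrite ler_distl; apply/andP; split.
  rewrite [leLHS](_ : _ = f x + (c - e) * t); last by ring.
  apply: dynkin_ge => // s st; have := Le s st; rewrite ler_distl; lra.
rewrite [leRHS](_ : _ = f x + (c + e) * t); last by ring.
apply: dynkin_le => // s st; have := Le s st; rewrite ler_distl; lra.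
Qed.

Lemma chapman_kolmogorov f M s t x :
  measurable_fun [set: R] f -> (forall y, `|f y| <= M) ->
  0 <= s -> 0 <= t -> 0 <= x ->
  \int[P (s + t) x]_y f y = \int[P s x]_y \int[P t y]_z f z.
Proof.
move=> mf fM s0 t0 x0; apply: (Rintegral_mixture _ mf fM) => B mB.
by case: P_La => -[_ _ +] _; apply.
Qed.

(** Jumps lower an increasing function, so the unbounded rate enters with a favourable sign and only
    the drift has to be estimated. *)
Lemma La_logistic_le l d y : 0 < l -> 0 < d -> 0 <= y ->
  La H a (logistic l d) y <= l * logistic l d y.
Proof.
move=> l0 d0 y0; rewrite (La_average H01 _ _ (logistic_lipschitz l0 d0)).
have /andP[_ g1] := derive1_logistic_le y l0 d0.
rewrite -[leRHS]addr0 lerD// pmulr_rle0; last by rewrite ltr_wpDl.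
rewrite subr_le0; apply: (average_le H01 (logistic_lipschitz l0 d0)) => //.
exact: logistic_homo.
Qed.

Lemma integrable_logistic k x l d : 0 < d ->
  (P k x).-integrable [set: R] (EFin \o logistic l d).
Proof.
move=> d0; apply: (@integrable_kernel _ _ _ _ d^-1).
  by apply: continuous_measurable_fun; exact: continuous_logistic.
by move=> y; rewrite ger0_norm ?logistic_le// ltW// logistic_gt0.
Qed.

(** Gronwall by bootstrap. The supremum [A] of the ratios of the expectation of [g] to [g x], over
    all times up to [r] and all [x >= 0], is finite because [g] lies between [g 0 > 0] and [1 / d]
    there. Dynkin's formula gives [A <= 1 + l r A], hence [A <= 1 + 2 l r] as [l r <= 1 / 2]. *)
Lemma logistic_growth_short l d r q x : 0 < l -> 0 < d -> 0 <= r ->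
  l * r <= 2^-1 -> 0 <= q <= r -> 0 <= x ->
  \int[P q x]_y logistic l d y <= (1 + 2 * (l * r)) * logistic l d x.
Proof.
move=> l0 d0 r0 lr; set g := logistic l d.
have g0 y : 0 < g y by exact: logistic_gt0.
pose E := [set u | exists q x, [/\ 0 <= q <= r, 0 <= x &
  u = (\int[P q x]_y g y) / g x]].
have Eub : ubound E (d^-1 / g 0).
  move=> _ [{}q [{}x [/andP[q0 _] x0 ->]]].
  rewrite ler_pM//.
  - by apply: Rintegral_ge0 => y _; exact: ltW.
  - by rewrite invr_ge0 ltW.
  - rewrite -(Rintegral_carried_cst d^-1 (carried_by_ge0 q0 x0)).
    apply: (le_Rintegral_carried (carried_by_ge0 q0 x0)).
    + exact: integrable_logistic.
    + exact: integrable_carried_cst (carried_by_ge0 q0 x0).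
    + by move=> y _; exact: logistic_le.
  - by rewrite lef_pV2 ?posrE//; exact: logistic_homo.
have hE : has_sup E.
  split; last by exists (d^-1 / g 0).
  by exists ((\int[P 0 0]_y g y) / g 0), 0, 0; split; rewrite ?lexx.
have supP q' x' : 0 <= q' <= r -> 0 <= x' ->
    \int[P q' x']_y g y <= sup E * g x'.
  move=> qr x'0; rewrite -ler_pdivrMr//; apply: ub_le_sup; first by case: hE.
  by exists q', x'.
have E0 : 0 <= sup E.
  have := supP 0 0; rewrite !lexx/= => /(_ r0 isT) h.
  rewrite -(@pmulr_lge0 _ (g 0))//; apply: le_trans h.
  by apply: Rintegral_ge0 => y _; exact: ltW.
have step q' x' : 0 <= q' <= r -> 0 <= x' ->
    \int[P q' x']_y g y <= (1 + (l * r) * sup E) * g x'.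
  move=> /andP[q'0 q'r] x'0.
  apply: (@le_trans _ _ (g x' + (l * (sup E * g x')) * q')).
    apply: dynkin_le => //; first exact: logistic_C1b.
    move=> s /andP[s0 sq'].
    apply: (@le_trans _ _ (l * \int[P s x']_y g y)).
      rewrite -RintegralZl//; last exact: integrable_logistic.
      apply: (le_Rintegral_carried (carried_by_ge0 s0 x'0)).
      - by apply: integrable_La => //; exact: logistic_C1b.
      - by apply: integrable_realZ => //; exact: integrable_logistic.
      - by move=> y /=; rewrite in_itv/= andbT; exact: La_logistic_le.
    rewrite ler_pM2l//; apply: supP => //; rewrite s0/=; lra.
  rewrite mulrDl mul1r lerD2l.
  rewrite [leRHS](_ : _ = (l * (sup E * g x')) * r); last by ring.
  by rewrite ler_wpM2l// mulr_ge0 ?mulr_ge0// ltW.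
have supE : sup E <= 1 + (l * r) * sup E.
  apply: ge_sup; first by case: hE.
  by move=> _ [q' [x' [q'r x'0 ->]]]; rewrite ler_pdivrMr//; exact: step.
move=> qr x0; apply: le_trans (supP _ _ qr x0) _; rewrite ler_pM2r//.
have : 0 <= l * r by rewrite mulr_ge0// ltW.
by move: (l * r) (sup E) lr supE E0 => th A; nra.
Qed.

Lemma logistic_growth l d t x : 0 < l -> 0 < d -> 0 <= t -> 0 <= x ->
  \int[P t x]_y logistic l d y <= expR (2 * l * t) * logistic l d x.
Proof.
move=> l0 d0 t0 x0; set g := logistic l d.
(* This makes the pieces [r = t / n.+1] satisfy [l * r <= 1 / 2], as the short time bound requires;
   the factors then multiply to at most [exp (2 l t)]. *)
have [n nlt] : exists n : nat, 2 * l * t <= n.+1%:R.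
  exists (Num.trunc (2 * l * t)); apply: ltW; exact: truncnS_gt.
have n0 : 0 < n.+1%:R :> R by rewrite ltr0n.
pose r := t / n.+1%:R.
have r0 : 0 <= r by rewrite divr_ge0.
have lr : l * r <= 2^-1.
  by rewrite /r mulrA ler_pdivrMr// ler_pdivlMl// mulrA.
have main k y : 0 <= y ->
    \int[P (k.+1%:R * r) y]_z g z <= (1 + 2 * (l * r)) ^+ k.+1 * g y.
  elim: k y => [|k IH] y y0.
    by rewrite mul1r expr1; apply: logistic_growth_short => //; rewrite r0 lexx.
  have k0 : 0 <= k.+1%:R * r by rewrite mulr_ge0.
  rewrite -[k.+2]addn1 natrD mulrDl mul1r.
  have mg : measurable_fun [set: R] g.
    by apply: continuous_measurable_fun; exact: continuous_logistic.
  have gd u : `|g u| <= d^-1.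
    by rewrite ger0_norm ?logistic_le// ltW// logistic_gt0.
  rewrite (chapman_kolmogorov mg gd)// addn1 exprS -mulrA.
  apply: (@le_trans _ _ (\int[P (k.+1%:R * r) y]_z ((1 + 2 * (l * r)) * g z))).
    apply: (le_Rintegral_carried (carried_by_ge0 k0 y0)).
    - apply: (@integrable_kernel _ _ _ _ d^-1).
        exact: measurable_kernel_Rintegral gd.
      by move=> u; exact: Rintegral_kernel_le.
    - by apply: integrable_realZ => //; exact: integrable_logistic.
    - move=> u /=; rewrite in_itv/= andbT => u0.
      by apply: logistic_growth_short => //; rewrite r0 lexx.
  rewrite RintegralZl//; last exact: integrable_logistic.
  by rewrite ler_wpM2l ?IH// addr_ge0// !mulr_ge0// ltW.
have -> : t = n.+1%:R * r by rewrite /r mulrCA divff ?mulr1// gt_eqF.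
apply: le_trans (main _ _ x0) _; rewrite ler_wpM2r//.
  by rewrite ltW// logistic_gt0.
rewrite (_ : 2 * l * (n.+1%:R * r) = n.+1%:R * (2 * (l * r))); last by ring.
rewrite expRM_natl; apply: lerXn2r; rewrite ?nnegrE ?expR_ge0//.
  by rewrite addr_ge0// !mulr_ge0// ltW.
exact: expR_ge1Dx.
Qed.

(* Chernoff bound: [logistic l d] is a bounded version of [exp (l y)], and the
   resulting bound on the tail is [2 * exp (- l t)] for every [l > 0]. *)
Lemma tail_null t x : 0 < t -> 0 <= x ->
  P t x `[x + 3 * t, +oo[ = 0%E.
Proof.
move=> t0 x0; set z := x + 3 * t; set A := `[z, +oo[%classic.
have mA : measurable A by exact: measurable_itv.
have fP : P t x A \is a fin_num.
  exact: carried_by_fin_num (carried_by_setT (P t) x) mA.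
rewrite -(fineK fP); congr (_%:E); set v := fine _.
have v0 : 0 <= v by exact: fine_ge0.
have iA : (P t x).-integrable [set: R] (EFin \o (\1_A : R -> R)).
  apply: (@integrable_kernel _ _ _ _ 1) => // y.
  by rewrite indicE; case: (y \in A); rewrite ?normr0 ?normr1.
have key l : 0 < l -> v * (1 + l * t) <= 2.
  (* With this [d] the two terms of the denominator are equal at [z], so that [logistic l d z] is
     half of the cap [d^-1]. *)
  move=> l0; pose d := expR (- (l * z)); have d0 : 0 < d by exact: expR_gt0.
  have gz : logistic l d z = (2 * d)^-1.
    by rewrite /logistic -/d; congr (_^-1); ring.
  have gx : logistic l d x <= expR (l * x).
    rewrite -[leRHS]invrK -expRN lef_pV2 ?posrE ?addr_gt0 ?expR_gt0//.
    by rewrite lerDl ltW.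
  have vg : v * (2 * d)^-1 <= \int[P t x]_y logistic l d y.
    rewrite mulrC.
    have -> : (2 * d)^-1 * v = \int[P t x]_y ((2 * d)^-1 * \1_A y).
      rewrite RintegralZl//.
      by rewrite /Rintegral integral_indic// setIT.
    apply: (le_Rintegral_carried (carried_by_ge0 (ltW t0) x0)).
    - by apply: integrable_realZ => //.
    - exact: integrable_logistic.
    move=> y _; rewrite indicE; case: (boolP (y \in A)); last first.
      by rewrite mulr0 ltW// logistic_gt0.
    rewrite inE /A/= in_itv/= andbT mulr1 -gz => zy; exact: logistic_homo.
  have : v * (2 * d)^-1 <= expR (2 * l * t) * expR (l * x).
    apply: le_trans vg _; apply: le_trans (logistic_growth l0 d0 (ltW t0) x0) _.
    by rewrite ler_pM2l ?expR_gt0.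
  rewrite ler_pdivrMr ?mulr_gt0// -expRD mulrCA -expRD => vd.
  have : v * expR (l * t) <= 2.
    rewrite -ler_pdivlMr ?expR_gt0// -expRN; apply: le_trans vd _.
    by rewrite ler_pM2l// ler_expR /z; nra.
  by apply: le_trans; rewrite ler_wpM2l// expR_ge1Dx.
apply/eqP; rewrite eq_le v0 andbT leNgt; apply/negP => vp.
(* For this [l] the bound [key] reads [v + 2 <= 2]. *)
have := key (2 / (v * t)); rewrite divr_gt0// ?mulr_gt0// => /(_ isT).
rewrite mulrDr mulr1 (_ : v * _ = 2); last by field; rewrite !gt_eqF.
lra.
Qed.

Lemma carried_by_itv t x : 0 <= t -> 0 <= x ->
  carried_by (P t x) `[0, x + 3 * t].
Proof.
move=> t0 x0; split => //; first exact: prob_kernel.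
(* Time 0 is separate: the mass then sits at the endpoint [x], which [tail_null] would exclude. *)
move: t0; rewrite le_eqVlt => /predU1P[<-|t0].
  case: P_La => -[_ -> // _] _.
  by rewrite diracE mem_set//= in_itv/= x0 mulr0 addr0 lexx.
have [_ _ P1] := carried_by_ge0 (ltW t0) x0.
apply/le_anti/andP; split.
  by have [_ _ <-] := carried_by_setT (P t) x; apply: le_measure; rewrite ?inE.
rewrite -P1 -[leRHS]adde0 -(tail_null t0 x0).
apply: le_trans (measureU2 _ _ _) => //.
apply: le_measure; rewrite ?inE//; first exact: measurableU.
move=> y /=; rewrite !in_itv/= !andbT => y0.
by have [yz|/ltW yz] := leP y (x + 3 * t); [left|right]; rewrite ?y0.
Qed.

End support.

(** * Short time expansion of the semigroup *)

Section displacement.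
Context (R : realType) (H : probability R R) (a : R).
Hypothesis H01 : H `[0, 1[%classic = 1%E.
Hypothesis a_gt0 : 0 < a.
Implicit Types (f : R -> R) (b c e l x y z s t L : R).

(** With [M = 4 * expR b]: [M] times a bound on [La] of [logistic 1 1] over [[0, b + 3]], plus
    [M + 1] times the speed 3 at which the support may extend upwards. *)
Definition displacement_rate b : R :=
  4 * expR b * (1 + (b + 3 + a) * (b + 3)) + 3 * (4 * expR b + 1).

Lemma displacement_rate_ge0 b : 0 <= b -> 0 <= displacement_rate b.
Proof.
move=> b0; have e0 := expR_ge0 b.
by rewrite /displacement_rate addr_ge0// ?mulr_ge0// ?addr_ge0// ?mulr_ge0//
  ?addr_ge0// ltW.
Qed.

(** The derivative of [logistic 1 1] is at least [exp (- b) / 4] on [[0, b]]; the inequality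
    [1 + u <= exp u] is enough to see it. *)
Lemma logistic11_dist b x y : 0 <= y -> y <= x -> x <= b ->
  x - y <= 4 * expR b * (logistic 1 1 x - logistic 1 1 y).
Proof.
move=> y0 yx xb; rewrite /logistic !mul1r.
have u0 := expR_gt0 (- x); have w0 := expR_gt0 (- y).
have u1 : expR (- x) <= 1 by rewrite -expR0 ler_expR; lra.
have w1 : expR (- y) <= 1 by rewrite -expR0 ler_expR; lra.
have wu : expR (- x) * (1 + (x - y)) <= expR (- y).
  have -> : expR (- y) = expR (- x) * expR (x - y) by rewrite -expRD; congr expR; ring.
  by rewrite ler_pM2l// expR_ge1Dx.
have bu : 1 <= expR b * expR (- x).
  by rewrite -expRD -[leLHS]expR0 ler_expR; lra.
have b0 := expR_gt0 b.
move: (expR (- x)) (expR (- y)) (expR b) u0 w0 u1 w1 wu bu b0.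
move=> u w c u0 w0 u1 w1 wu bu c0.
rewrite (_ : (u + 1)^-1 - (w + 1)^-1 = (w - u) / ((u + 1) * (w + 1))); last first.
  by field; rewrite !gt_eqF//; lra.
rewrite mulrA ler_pdivlMr; last nra.
apply: (@le_trans _ _ ((x - y) * 4)).
  by rewrite ler_wpM2l//; [lra|nra].
have : x - y <= c * (w - u).
  apply: (@le_trans _ _ (c * (u * (x - y)))).
    by rewrite mulrA ler_peMl//; lra.
  by rewrite ler_pM2l//; lra.
lra.
Qed.

Section one_semigroup.
Variable P : R -> R.-pker R ~> R.
Hypothesis P_La : semigroup_La H a P.

Lemma carried_by_short b s x : 0 <= x <= b -> 0 <= s <= 1 ->
  carried_by (P s x) `[0, b + 3].
Proof.
move=> /andP[x0 xb] /andP[s0 s1].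
apply: carried_by_sub (carried_by_itv H01 a_gt0 P_La s0 x0) _ _ => //.
by move=> y /=; rewrite !in_itv/=; lra.
Qed.

(** The identity is unbounded, hence not in [C1b]. Downward moves are measured through
    [logistic 1 1] instead, and upward moves are at most [3 * s] by the support bound. *)
Lemma displacement b s x : 0 <= x <= b -> 0 <= s <= 1 ->
  \int[P s x]_y `|y - x| <= displacement_rate b * s.
Proof.
move=> xb s01; have a0 := a_gt0; have /andP[x0 xb'] := xb; have /andP[s0 s1] := s01.
set phi : R -> R := logistic 1 1; set M := 4 * expR b.
have M0 : 0 <= M by rewrite mulr_ge0// expR_ge0.
have phil : lipschitz_with 1 phi.
  by have := @logistic_lipschitz R 1 1 ltr01 ltr01; rewrite invr1 mulr1.
have cs := carried_by_itv H01 a_gt0 P_La s0 x0.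
have c1 : `|\int[P s x]_y phi y - phi x| <= (1 + (b + 3 + a) * (b + 3)) * s.
  have phiC : C1b phi by exact: logistic_C1b.
  have := @dynkin_close _ _ _ _ P_La phi 0 (1 + (b + 3 + a) * (b + 3)) s x phiC s0 x0.
  rewrite mul0r addr0; apply=> r /andP[r0 rs]; have r1 : 0 <= r <= 1 by lra.
  apply: (Rintegral_carried_bound (carried_by_short xb r1)).
    exact: (integrable_La P_La).
  move=> y /=; rewrite in_itv/= subr0 => /andP[y0 yb].
  rewrite (La_average H01 _ _ phil); apply: le_trans (ler_normD _ _) _; apply: lerD.
    by have := @derive1_logistic_bound R 1 1 y ltr01 ltr01; rewrite invr1 mulr1.
  rewrite normrM ler_pM//; first by rewrite ger0_norm; lra.
  apply: le_trans (average_self H01 _ phil) _.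
  have := kappa1_ge0 H01; have := kappa1_le1 H.
  by rewrite mul1r (ger0_norm y0); move: (kappa1 H) => k k0 k1; nra.
have ci : (P s x).-integrable [set: R]
    (EFin \o (fun y => M * (phi x - phi y) + (M + 1) * (3 * s))).
  apply: (integrable_carried (M := M * x + M * (x + 3 * s) + (M + 1) * (3 * s)) cs).
    apply: measurable_funD => //; apply: measurable_funM => //.
    by apply: measurable_funB => //; exact: lipschitz_with_measurable phil.
  move=> y /=; rewrite in_itv/= => /andP[y0 yb].
  apply: le_trans (ler_normD _ _) _; rewrite lerD//; last first.
    by rewrite ger0_norm// !mulr_ge0// addr_ge0.
  rewrite normrM ger0_norm// -mulrDr ler_wpM2l//.
  by apply: le_trans (phil _ _) _; rewrite mul1r ler_norml; lra.
(* For [y <= x] the first term dominates. For [y > x] it is at least [- M * (3 * s)], because [phi]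
   is 1-Lipschitz, and [3 * s] is left over. *)
apply: (@le_trans _ _ (\int[P s x]_y (M * (phi x - phi y) + (M + 1) * (3 * s)))).
  apply: (le_Rintegral_carried cs) => //.
    apply: (integrable_carried (M := x + (x + 3 * s)) cs).
      by apply: measurableT_comp => //; exact: measurable_funB.
    by move=> y /=; rewrite in_itv/= normr_id ler_norml; lra.
  move=> y /=; rewrite in_itv/= => /andP[y0 yb].
  have [yx|xy] := leP y x.
    rewrite ler0_norm; last lra.
    have := logistic11_dist y0 yx xb'; rewrite -/phi -/M.
    have : 0 <= (M + 1) * (3 * s) by rewrite !mulr_ge0// addr_ge0.
    lra.
  rewrite gtr0_norm; last lra.
  have : phi y - phi x <= 3 * s.
    apply: le_trans (ler_norm _) _; apply: le_trans (phil _ _) _.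
    by rewrite mul1r gtr0_norm; lra.
  nra.
have phii : (P s x).-integrable [set: R] (EFin \o phi) by exact: integrable_logistic.
rewrite RintegralD//; last 2 first.
- apply: integrable_realZ => //; apply: integrable_realB => //.
  exact: (integrable_carried_cst (phi x) cs).
- exact: (integrable_carried_cst _ cs).
rewrite RintegralZl//; last first.
  by apply: integrable_realB => //; exact: (integrable_carried_cst (phi x) cs).
rewrite RintegralB//; last exact: (integrable_carried_cst (phi x) cs).
rewrite !(Rintegral_carried_cst _ cs).
rewrite [leRHS](_ : _ = M * ((1 + (b + 3 + a) * (b + 3)) * s) + (M + 1) * (3 * s)).
  by rewrite lerD2r ler_wpM2l//; move: c1; rewrite ler_norml; lra.
by rewrite /displacement_rate -/M; ring.
Qed.

(** Meant for [La H a f] and [jump f], which are Lipschitz on compacts but need not belong to [C1b],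
    so that Dynkin's formula cannot be applied to them. *)
Lemma semigroup_lipschitz_close b c s x f :
  measurable_fun [set: R] f -> 0 <= c ->
  (forall y z, 0 <= y <= b + 3 -> 0 <= z <= b + 3 -> `|f y - f z| <= c * `|y - z|) ->
  0 <= x <= b -> 0 <= s <= 1 ->
  `|\int[P s x]_y f y - f x| <= c * displacement_rate b * s.
Proof.
move=> mf c0 fc xb s01; have cs := carried_by_short xb s01.
have xb3 : 0 <= x <= b + 3 by lra.
have fi : (P s x).-integrable [set: R] (EFin \o f).
  apply: (integrable_carried (M := `|f x| + c * (x + (b + 3))) cs) => //.
  move=> y /=; rewrite in_itv/= => yb.
  rewrite -[f y](subrK (f x)) addrC; apply: le_trans (ler_normD _ _) _.
  rewrite lerD2l; apply: le_trans (fc _ _ yb xb3) _; rewrite ler_wpM2l//.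
  by rewrite ler_norml; lra.
have xi : (P s x).-integrable [set: R] (EFin \o (fun y => `|y - x|)).
  apply: (integrable_carried (M := x + (b + 3)) cs).
    by apply: measurableT_comp => //; exact: measurable_funB.
  by move=> y /=; rewrite in_itv/= normr_id ler_norml; lra.
have fxi := integrable_carried_cst (f x) cs.
rewrite -{1}(Rintegral_carried_cst (f x) cs) -RintegralB//.
apply: le_trans (le_normr_Rintegral _ _) _ => //; first exact: integrable_realB.
apply: (@le_trans _ _ (\int[P s x]_y (c * `|y - x|))).
  apply: (le_Rintegral_carried cs).
  - by apply: integrable_real_norm => //; exact: integrable_realB.
  - exact: integrable_realZ.
  - by move=> y /=; rewrite in_itv/= => yb; exact: fc.
by rewrite RintegralZl// -mulrA ler_wpM2l//; exact: displacement.
Qed.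

End one_semigroup.

End displacement.

(** * Expansion to second order and the contraction it implies *)

Section short_time_expansion.
Context (R : realType) (H : probability R R) (a : R).
Hypothesis H01 : H `[0, 1[%classic = 1%E.
Hypothesis a_gt0 : 0 < a.
Implicit Types (f : R -> R) (b c e l x y z s t L : R).

Definition jump f x : R := (x + a) * (average H f x - f x).

Lemma average_close f g e x l l' : lipschitz_with l f -> lipschitz_with l' g ->
  (forall y, `|f y - g y| <= e) -> `|average H f x - average H g x| <= e.
Proof.
move=> fl gl fge; have fi := integrable_01_scale H01 x fl.
have gi := integrable_01_scale H01 x gl.
rewrite -RintegralB//; apply: le_trans (le_normr_Rintegral _ _) _ => //.
  exact: integrable_realB.
rewrite -[leRHS](Rintegral_01_cst H01); apply: le_Rintegral => //.
- by apply: integrable_real_norm => //; exact: integrable_realB.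
- exact: integrable_01_cst.
Qed.

Definition test_function L f : Prop :=
  [/\ C1b f, lipschitz_with 1 f & lipschitz_with L (derive1 f)].

Lemma derive1_shift f t y : (forall x, derivable f x 1) ->
  is_derive y 1 (fun x => f (x + t)) (derive1 f (y + t)).
Proof.
move=> df.
have d1 : is_derive (y + t) 1 f (derive1 f (y + t)).
  by rewrite derive1E; exact: derivableP.
have d2 : is_derive y 1 (fun x => x + t) 1.
  by apply: is_derive_eq; rewrite addr0.
have := @is_derive1_comp _ f (fun x => x + t) y _ _ d1 d2.
by rewrite mulr1.
Qed.

(** The shift is the flow of the drift. Stability of the class with the same [L] lets the induction
    of [iterated_steps] pass from [f] to its shift. *)
Lemma test_function_shift L f t :
  test_function L f -> test_function L (fun y => f (y + t)).
Proof.
move=> [[df cf' [M fM] [M' f'M]] f1 f'L].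
have dE : derive1 (fun y => f (y + t)) = fun y => derive1 f (y + t).
  by apply/funext => y; rewrite derive1E; have [_ ->] := derive1_shift t y df.
have fl : lipschitz_with L (fun y => derive1 f (y + t)).
  by move=> y z; apply: le_trans (f'L _ _) _; rewrite opprD addrACA subrr addr0.
split; last by rewrite dE.
- split.
  + by move=> x; have [] := derive1_shift t x df.
  + by rewrite dE; exact: lipschitz_with_continuous fl.
  + by exists M => x.
  + by exists M' => x; rewrite dE.
- by move=> y z; apply: le_trans (f1 _ _) _; rewrite opprD addrACA subrr addr0.
Qed.

Lemma test_function_taylor L f x t : test_function L f -> 0 <= t ->
  `|f (x + t) - (f x + derive1 f x * t)| <= L * t ^+ 2.
Proof.
move=> [[df _ _ _] _ f'L] t0; have L0 := lipschitz_with_ge0 f'L.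
have [c] : exists2 c, c \in `[x, x + t]%R & f (x + t) - f x = derive1 f c * (x + t - x).
  apply: MVT_segment; first lra.
    by move=> y _; rewrite derive1E; apply: derivableP.
  apply: continuous_subspaceT => y; apply: differentiable_continuous.
  by apply/derivable1_diffP.
rewrite in_itv/= => cx fE.
rewrite (_ : _ - _ = (derive1 f c - derive1 f x) * t); last first.
  by rewrite opprD addrA fE; ring.
rewrite normrM (ger0_norm t0) expr2 mulrA ler_wpM2r//.
apply: le_trans (f'L _ _) _; rewrite ler_wpM2l// ger0_norm; lra.
Qed.

(** Product rule for [(y + a) * (average H f y - f y)] on [[0, b]]: the second factor is 2-Lipschitz
    and bounded by [b]. *)
Definition jump_slope b : R := 2 * (b + a) + b.

Lemma jump_slope_ge0 b : 0 <= b -> 0 <= jump_slope b.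
Proof. by have a0 := a_gt0; rewrite /jump_slope; lra. Qed.

Lemma average_diff_dist f y z : lipschitz_with 1 f ->
  `|(average H f y - f y) - (average H f z - f z)| <= 2 * `|y - z|.
Proof.
move=> f1.
rewrite (_ : _ - _ = (average H f y - average H f z) - (f y - f z)); last by ring.
apply: le_trans (ler_normB _ _) _; rewrite mulrDl mul1r; apply: lerD.
  apply: le_trans (average_dist H01 _ _ f1) _; rewrite mul1r ler_piMl//.
  by have := kappa1_ge0 H01; lra.
by apply: le_trans (f1 _ _) _; rewrite mul1r.
Qed.

Lemma jump_dist b f y z : lipschitz_with 1 f -> 0 <= y <= b -> 0 <= z <= b ->
  `|jump f y - jump f z| <= jump_slope b * `|y - z|.
Proof.
move=> f1 /andP[y0 yb] /andP[z0 zb]; have a0 := a_gt0.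
rewrite (_ : _ - _ = (y + a) * ((average H f y - f y) - (average H f z - f z)) +
   (y - z) * (average H f z - f z)); last by rewrite /jump; ring.
apply: le_trans (ler_normD _ _) _.
rewrite [leRHS](_ : _ = (b + a) * (2 * `|y - z|) + b * `|y - z|); last first.
  by rewrite /jump_slope; ring.
apply: lerD.
  rewrite normrM ger0_norm; last lra.
  by apply: ler_pM => //; [lra|lra|exact: average_diff_dist].
rewrite normrM mulrC ler_wpM2r//.
apply: le_trans (average_self H01 _ f1) _.
rewrite mul1r (ger0_norm z0); apply: le_trans zb.
by rewrite ler_piMl// kappa1_le1.
Qed.

Lemma continuous_jump f : lipschitz_with 1 f -> continuous (jump f).
Proof.
move=> f1 x; apply: cvgM; first by apply: cvgD; [exact: cvg_id|exact: cvg_cst].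
by apply: (@lipschitz_with_continuous _ 2 (fun y => average H f y - f y)) => y z;
  exact: average_diff_dist.
Qed.

Lemma La_jump f x : lipschitz_with 1 f -> La H a f x = derive1 f x + jump f x.
Proof. by move=> f1; rewrite (La_average H01 _ _ f1). Qed.

Section one_semigroup_expansion.
Variable P : R -> R.-pker R ~> R.
Hypothesis P_La : semigroup_La H a P.

(** A Lipschitz constant of [La H a f] on [[0, b + 3]] times the displacement rate, plus the Taylor
    remainder of [f]. *)
Definition one_step_constant b L : R :=
  (L + jump_slope (b + 3)) * displacement_rate a b + L.

(** Dynkin's formula with [La H a f] frozen at [x]. The drift is then put back inside [f], as a
    shift, because in this form it accumulates no error under iteration. *)
Lemma one_step b L f x t : test_function L f -> 0 <= x <= b -> 0 <= t <= 1 ->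
  `|\int[P t x]_y f y - (f (x + t) + t * jump f x)| <=
  one_step_constant b L * t ^+ 2.
Proof.
move=> Lf xb /andP[t0 t1]; have [Cf f1 f'L] := Lf.
have L0 := lipschitz_with_ge0 f'L; have /andP[x0 xb'] := xb.
have b0 : 0 <= b by lra.
have j0 : 0 <= jump_slope (b + 3) by apply: jump_slope_ge0; lra.
have d0 := displacement_rate_ge0 a_gt0 b0.
have mLa : measurable_fun [set: R] (La H a f).
  rewrite (_ : La H a f = fun y => derive1 f y + jump f y); last first.
    by apply/funext => y; exact: La_jump.
  apply: measurable_funD; first by apply: continuous_measurable_fun; case: Cf.
  by apply: continuous_measurable_fun; exact: continuous_jump.
have dyn : `|\int[P t x]_y f y - (f x + La H a f x * t)| <=
    ((L + jump_slope (b + 3)) * displacement_rate a b * t) * t.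
  apply: (dynkin_close P_La) => // s /andP[s0 st].
  have s1 : 0 <= s <= 1 by lra.
  apply: (@le_trans _ _ ((L + jump_slope (b + 3)) * displacement_rate a b * s)).
    apply: (semigroup_lipschitz_close H01 a_gt0 P_La) => //; first lra.
    move=> y z yb zb; rewrite !La_jump// opprD addrACA mulrDl.
    apply: le_trans (ler_normD _ _) _; apply: lerD; first exact: f'L.
    exact: jump_dist.
  by rewrite ler_wpM2l// mulr_ge0//; lra.
have tay := test_function_taylor x Lf t0.
rewrite (_ : _ - _ = (\int[P t x]_y f y - (f x + La H a f x * t)) -
  (f (x + t) - (f x + derive1 f x * t))); last by rewrite La_jump//; ring.
apply: le_trans (ler_normB _ _) _.
rewrite [leRHS](_ : _ = ((L + jump_slope (b + 3)) * displacement_rate a b * t) * t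
  + L * t ^+ 2); last by rewrite /one_step_constant; ring.
exact: lerD.
Qed.

(** First the variation of [jump f] along the process, then the change of [jump f x] when [f] is
    shifted. Both use only that [f] is 1-Lipschitz. *)
Definition expansion_constant b : R :=
  jump_slope (b + 3) * displacement_rate a b + 2 * (b + a).

(* Each step costs [one_step_constant (b + 3) L * t ^+ 2]; this depends on the
   Lipschitz constant [L] of [f'] but is quadratic in the mesh [t], whereas the
   remaining error does not involve [L]. *)
Lemma iterated_steps b L f x t e n : test_function L f -> 0 <= x <= b ->
  0 <= t -> n%:R * t <= e -> e <= 1 ->
  `|\int[P (n%:R * t) x]_y f y -
    (f (x + n%:R * t) + (n%:R * t) * jump f x)| <=
  (n%:R * t) * (expansion_constant b * e) +
  n%:R * (one_step_constant (b + 3) L * t ^+ 2).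
Proof.
move=> + xb t0 + e1; have a0 := a_gt0; have /andP[x0 xb'] := xb.
have b0 : 0 <= b by lra.
have j0 : 0 <= jump_slope (b + 3) by apply: jump_slope_ge0; lra.
have d0 := displacement_rate_ge0 a_gt0 b0.
elim: n f => [|n IH] f Lf nte.
  rewrite !mul0r !addr0.
  case: P_La => -[_ P0 _] _.
  rewrite /Rintegral (_ : integral _ _ _ = (f x)%:E) ?subrr ?normr0//.
  rewrite (eq_measure_integral (\d_x)); last by move=> A mA _; exact: P0.
  rewrite integral_dirac ?diracT ?mul1e//.
  by apply/measurable_EFinP; case: Lf => _ /lipschitz_with_measurable.
have nt0 : 0 <= n%:R * t by rewrite mulr_ge0.
have ntS : n.+1%:R * t = n%:R * t + t by rewrite -addn1 natrD mulrDl mul1r.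
move: nte; rewrite ntS => nte.
have nt1 : 0 <= n%:R * t <= 1 by lra.
have t1 : 0 <= t <= 1 by lra.
have nte' : n%:R * t <= e by lra.
have [[df _ [M fM] _] f1 f'L] := Lf.
have mf := lipschitz_with_measurable f1.
have sLf := test_function_shift t Lf.
have {}IH := IH _ sLf nte'.
rewrite (chapman_kolmogorov P_La mf fM)//.
set g := fun y => f (y + t) in IH sLf.
have [Cg g1 _] := sLf.
have cnt := carried_by_short H01 a_gt0 P_La xb nt1.
have gi : (P (n%:R * t) x).-integrable [set: R] (EFin \o g).
  apply: (integrable_kernel _ _ (lipschitz_with_measurable g1) (M := M)) => y.
  exact: fM.
have mj : measurable_fun [set: R] (jump f).
  by apply: continuous_measurable_fun; exact: continuous_jump.
have ji : (P (n%:R * t) x).-integrable [set: R] (EFin \o jump f).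
  apply: (integrable_carried (M := (b + 3 + a) * (b + 3)) cnt) => //.
  move=> y /=; rewrite in_itv/= => /andP[y0 yb].
  rewrite /jump normrM ler_pM//; first by rewrite ger0_norm; lra.
  apply: le_trans (average_self H01 _ f1) _; rewrite mul1r (ger0_norm y0).
  by apply: le_trans yb; rewrite ler_piMl// kappa1_le1.
have tji : (P (n%:R * t) x).-integrable [set: R] (EFin \o (fun y => t * jump f y)).
  exact: integrable_realZ.
(* The last step starts from a point of [[0, b + 3]], whence the constant taken at [b + 3]. *)
have step : `|\int[P (n%:R * t) x]_y (\int[P t y]_z f z) -
    (\int[P (n%:R * t) x]_y g y + t * \int[P (n%:R * t) x]_y jump f y)| <=
    one_step_constant (b + 3) L * t ^+ 2.
  rewrite -RintegralZl// -RintegralD//.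
  apply: (Rintegral_carried_close cnt).
  - apply: (@integrable_kernel _ _ _ _ M).
      exact: measurable_kernel_Rintegral fM.
    by move=> u; exact: Rintegral_kernel_le.
  - exact: integrable_realD.
  - by move=> y /=; rewrite in_itv/= => yb; exact: one_step.
have jclose : `|\int[P (n%:R * t) x]_y jump f y - jump f x| <=
    jump_slope (b + 3) * displacement_rate a b * e.
  apply: (@le_trans _ _ (jump_slope (b + 3) * displacement_rate a b * (n%:R * t))).
    apply: (semigroup_lipschitz_close H01 a_gt0 P_La) => // y z yb zb.
    exact: jump_dist.
  by rewrite ler_wpM2l// mulr_ge0.
have gf y : `|g y - f y| <= t.
  by apply: le_trans (f1 _ _) _; rewrite mul1r [y + t]addrC addrK ger0_norm.
(* The induction hypothesis is about the shift [g] and so produces [jump g x]; since [g] is within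
   [t] of [f], returning to [jump f x] does not involve [L]. *)
have jshift : `|jump g x - jump f x| <= 2 * (b + a) * t.
  rewrite -mulrBr normrM ger0_norm; last lra.
  rewrite (_ : _ - _ - _ = (average H g x - average H f x) - (g x - f x)); last by ring.
  rewrite [2 * _]mulrC -mulrA; apply: ler_pM => //; [lra|lra|].
  apply: le_trans (ler_normB _ _) _; rewrite mulrDl mul1r lerD//.
  exact: average_close g1 f1 gf.
rewrite addrA -/(g _).
set A := \int[P (n%:R * t) x]_y (\int[P t y]_z f z) in step *.
set G := \int[P (n%:R * t) x]_y g y in step IH.
set J := \int[P (n%:R * t) x]_y jump f y in step jclose.
rewrite (_ : A - _ = (A - (G + t * J)) +
  ((G - (g (x + n%:R * t) + n%:R * t * jump g x)) +
   (t * (J - jump f x) + (n%:R * t) * (jump g x - jump f x)))); last by ring.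
apply: (@le_trans _ _ (one_step_constant (b + 3) L * t ^+ 2 +
  ((n%:R * t * (expansion_constant b * e) +
    n%:R * (one_step_constant (b + 3) L * t ^+ 2)) +
   (t * (jump_slope (b + 3) * displacement_rate a b * e) +
    e * (2 * (b + a) * t))))); last first.
  by rewrite le_eqVlt; apply/orP; left; apply/eqP;
    rewrite -[n.+1]addn1 natrD /expansion_constant; ring.
apply: le_trans (ler_normD _ _) _; apply: lerD => //.
apply: le_trans (ler_normD _ _) _; apply: lerD => //.
apply: le_trans (ler_normD _ _) _; apply: lerD; rewrite normrM ger0_norm//.
  exact: ler_wpM2l.
exact: ler_pM.
Qed.

Lemma expansion b L f x e : test_function L f -> 0 <= x <= b -> 0 <= e <= 1 ->
  `|\int[P e x]_y f y - (f (x + e) + e * jump f x)| <=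
  expansion_constant b * e ^+ 2.
Proof.
move=> Lf xb /andP[e0 e1]; apply/ler_addgt0Pr => d d0.
have a0 := a_gt0; have /andP[x0 xb'] := xb; have b0 : 0 <= b by lra.
set C := one_step_constant (b + 3) L.
have C0 : 0 <= C.
  have L0 : 0 <= L by case: Lf => _ _ /lipschitz_with_ge0.
  rewrite /C /one_step_constant addr_ge0// mulr_ge0//.
    by rewrite addr_ge0// jump_slope_ge0//; lra.
  by apply: (displacement_rate_ge0 a_gt0); lra.
have [n Cn] : exists n : nat, C * e ^+ 2 / d <= n.+1%:R.
  by exists (Num.trunc (C * e ^+ 2 / d)); apply: ltW; exact: truncnS_gt.
have n0 : 0 < n.+1%:R :> R by rewrite ltr0n.
have ne : n.+1%:R * (e / n.+1%:R) = e by field; rewrite gt_eqF.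
have := @iterated_steps b L f x (e / n.+1%:R) e n.+1 Lf xb.
rewrite ne lexx divr_ge0// => /(_ isT isT e1) h; apply: le_trans h _.
rewrite -/C [e * _]mulrC -mulrA -expr2 lerD2l.
rewrite (_ : _ * _ = C * e ^+ 2 / n.+1%:R); last by field; rewrite gt_eqF.
by rewrite ler_pdivrMr// [d * _]mulrC -ler_pdivrMr.
Qed.

End one_semigroup_expansion.

(** One expansion error for each of the two semigroups, plus the error of [euler_contraction]. *)
Definition contraction_constant b : R :=
  2 * expansion_constant b + 2 * (b + a) + b.

Lemma contraction_constant_ge0 b : 0 <= b -> 0 <= contraction_constant b.
Proof.
move=> b0; have a0 := a_gt0; have d0 := displacement_rate_ge0 a_gt0 b0.
have j0 : 0 <= jump_slope (b + 3) by apply: jump_slope_ge0; lra.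
have : 0 <= jump_slope (b + 3) * displacement_rate a b by rewrite mulr_ge0.
by rewrite /contraction_constant /expansion_constant; lra.
Qed.

(* The jump rates differ by [x - y].  This excess is charged to the lower point
   [y], where it costs at most [kappa1 H * y], less than the gain
   [kappa1 H * (x + a)] that comes from the simultaneous jumps. *)
Lemma euler_contraction b f x y e : lipschitz_with 1 f ->
  0 <= y -> y <= x -> x <= b -> 0 <= e -> e * (b + a) <= 1 ->
  `|f (x + e) + e * jump f x - (f (y + e) + e * jump f y)| <=
  expR (- (a * kappa1 H * e)) * (x - y) + (2 * (b + a) + b) * e ^+ 2.
Proof.
move=> f1 y0 yx xb e0 eb; have a0 := a_gt0; set k := kappa1 H.
have k0 : 0 <= k := kappa1_ge0 H01; have k1 : k <= 1 := kappa1_le1 H.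
set Ax := average H f x; set Ay := average H f y.
have fe z : `|f (z + e) - f z| <= e.
  by apply: le_trans (f1 _ _) _; rewrite mul1r [z + e]addrC addrK ger0_norm.
(* In order: no jump, a common jump at rate [x + a], the correction for the smaller rate at [y], and
   terms of second order in [e]. *)
rewrite (_ : _ - _ = ((1 - e * (x + a)) * (f (x + e) - f (y + e)) +
   (e * (x + a) * (Ax - Ay) + e * (x - y) * ((Ay - f y) - (f (y + e) - f y)))) +
   (e * (x + a) * (f (x + e) - f x) - e * (y + a) * (f (y + e) - f y))); last first.
  by rewrite /jump -/Ax -/Ay; ring.
apply: (@le_trans _ _ (((1 - e * (x + a)) * (x - y) +
   (e * (x + a) * ((1 - k) * (x - y)) + e * (x - y) * (k * y + e))) +
   (e * (x + a) * e + e * (y + a) * e))).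
  have xa : 0 <= e * (x + a) by rewrite mulr_ge0//; lra.
  have ya : 0 <= e * (y + a) by rewrite mulr_ge0//; lra.
  have xa1 : e * (x + a) <= 1.
    by apply: le_trans eb; rewrite ler_wpM2l//; lra.
  have exy : 0 <= e * (x - y) by rewrite mulr_ge0//; lra.
  have xy : `|x - y| = x - y by rewrite ger0_norm; lra.
  apply: le_trans (ler_normD _ _) _; apply: lerD.
    apply: le_trans (ler_normD _ _) _; apply: lerD.
      rewrite normrM ger0_norm; last lra.
      rewrite ler_wpM2l//; first lra.
      by apply: le_trans (f1 _ _) _; rewrite mul1r opprD addrACA subrr addr0 xy.
    apply: le_trans (ler_normD _ _) _; apply: lerD.
      rewrite normrM ger0_norm// ler_wpM2l//.
      by apply: le_trans (average_dist H01 _ _ f1) _; rewrite mul1r xy.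
    rewrite normrM ger0_norm// ler_wpM2l//.
    apply: le_trans (ler_normB _ _) _; apply: lerD => //.
    by apply: le_trans (average_self H01 _ f1) _; rewrite mul1r (ger0_norm y0).
  apply: le_trans (ler_normB _ _) _; apply: lerD.
    by rewrite normrM ger0_norm// ler_wpM2l.
  by rewrite normrM ger0_norm// ler_wpM2l.
apply: (@le_trans _ _ ((1 - a * k * e) * (x - y) + (2 * (b + a) + b) * e ^+ 2)).
  (* The square comes from the surplus [k * (x + a) - k * y - a * k = k * (x - y)] of the gain over
     what is claimed. *)
  rewrite -subr_ge0 (_ : _ - _ = (e * k) * (x - y) ^+ 2 +
    ((b - x) + (b - y) + (b - (x - y))) * e ^+ 2); last by ring.
  by rewrite addr_ge0// mulr_ge0 ?sqr_ge0//; [exact: mulr_ge0|lra].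
rewrite lerD2r ler_wpM2r//; first lra.
by apply: le_trans (expR_ge1Dx _); lra.
Qed.

Lemma short_time_contraction (P Q : R -> R.-pker R ~> R) b L f x y e :
  semigroup_La H a P -> semigroup_La H a Q ->
  test_function L f -> 0 <= x <= b -> 0 <= y <= b -> 0 <= e <= 1 ->
  e * (b + a) <= 1 ->
  `|\int[P e x]_z f z - \int[Q e y]_z f z| <=
  expR (- (a * kappa1 H * e)) * `|x - y| + contraction_constant b * e ^+ 2.
Proof.
move=> PL QL Lf xb yb e01 eb; have /andP[e0 e1] := e01; have [_ f1 _] := Lf.
have /andP[x0 xb'] := xb; have /andP[y0 yb'] := yb.
have euler : `|f (x + e) + e * jump f x - (f (y + e) + e * jump f y)| <=
    expR (- (a * kappa1 H * e)) * `|x - y| + (2 * (b + a) + b) * e ^+ 2.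
  have [yx|/ltW xy] := leP y x.
    by rewrite [`|x - y|]ger0_norm ?subr_ge0//; exact: euler_contraction.
  rewrite distrC [`|x - y|]distrC [`|y - x|]ger0_norm ?subr_ge0//.
  exact: euler_contraction.
have Pe := expansion PL Lf xb e01.
have Qe := expansion QL Lf yb e01.
rewrite (_ : _ - _ = (\int[P e x]_z f z - (f (x + e) + e * jump f x)) +
  ((f (x + e) + e * jump f x - (f (y + e) + e * jump f y)) -
   (\int[Q e y]_z f z - (f (y + e) + e * jump f y)))); last by ring.
apply: le_trans (ler_normD _ _) _.
apply: le_trans (lerD Pe (ler_normB _ _)) _.
apply: le_trans (lerD (lexx _) (lerD euler Qe)) _.
by rewrite le_eqVlt; apply/orP; left; apply/eqP; rewrite /contraction_constant; ring.
Qed.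

End short_time_expansion.

(** * Duality for the L1 distance of tails *)

Section kernel_law.
Context (R : realType) (k : R.-pker R ~> R) (x : R).

(** Bundles [k x] as a probability, the type on which [W1] and [tail_distance] are defined. *)
Definition kernel_law : set R -> \bar R := k x.

HB.instance Definition _ := Measure.on kernel_law.

Let kernel_law_setT : kernel_law [set: R] = 1%E.
Proof. exact: prob_kernel. Qed.

HB.instance Definition _ :=
  Measure_isProbability.Build _ _ _ kernel_law kernel_law_setT.

End kernel_law.

Section clip.
Context (R : realType).
Implicit Types (u v : R).

Definition clip (lo hi u : R) : R := Num.min hi (Num.max lo u).

Lemma clip_itv lo hi u : lo <= hi -> lo <= clip lo hi u <= hi.
Proof.
move=> lohi; rewrite /clip /Num.min /Num.max.
by case: (ltP lo u) => ?; case: ltP => ?; lra.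
Qed.

Lemma clip_dist lo hi u v : lo <= hi -> `|clip lo hi u - clip lo hi v| <= `|u - v|.
Proof.
move=> lohi; have [vu|uv] := leP v u.
  rewrite (ger0_norm (_ : 0 <= u - v)); last lra.
  rewrite /clip /Num.min /Num.max ler_norml.
  by case: (ltP lo u) => ?; case: (ltP lo v) => ?;
    case: ltP => ?; try case: ltP => ?; lra.
rewrite (ltr0_norm (_ : u - v < 0)); last lra.
rewrite /clip /Num.min /Num.max ler_norml.
by case: (ltP lo u) => ?; case: (ltP lo v) => ?;
  case: ltP => ?; try case: ltP => ?; lra.
Qed.

Lemma clip_hi lo hi u : lo <= hi -> hi <= u -> clip lo hi u = hi.
Proof.
move=> lohi ubd; rewrite /clip /Num.min /Num.max.
by case: (ltP lo u) => ?; case: ltP => ?; lra.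
Qed.

Lemma clip_lo lo hi u : lo <= hi -> u <= lo -> clip lo hi u = lo.
Proof.
move=> lohi ubd; rewrite /clip /Num.min /Num.max.
by case: (ltP lo u) => ?; case: ltP => ?; lra.
Qed.

End clip.

(** * Layer cake formula and tails *)

Section layer_cake.
Context (R : realType).
Implicit Types (x y s : R).

Definition layer x s : R := (s <= x)%R%:R.

Lemma layer_dist_indic x y : x <= y ->
  (fun s => `|layer x s - layer y s|) = \1_(`]x, y]%classic).
Proof.
move=> xy; apply/funext => s; rewrite /layer indicE mem_setE/= in_itv/=.
have [sx|xs] := leP s x; last by case: (s <= y); rewrite sub0r normrN ?normr0 ?normr1.
by rewrite (le_trans sx xy) subrr normr0.
Qed.

(** The integrand is the indicator of an interval of length [|x - y|]. This turns the cost of a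
    coupling into an integral over levels [s]. *)
Lemma integral_layer_dist x y :
  (\int[lebesgue_measure]_s `|layer x s - layer y s|%:E = `|x - y|%:E)%E.
Proof.
wlog xy : x y / x <= y => [hw|].
  have [xy|/ltW yx] := leP x y; first exact: hw.
  rewrite distrC -hw//; apply: eq_integral => s _; by rewrite distrC.
transitivity (\int[lebesgue_measure]_s ((\1_(`]x, y]%classic) s : R)%:E))%E.
  by apply: eq_integral => s _; rewrite -layer_dist_indic.
rewrite integral_indic// setIT /= lebesgue_measure_itv/= lte_fin.
rewrite distrC ger0_norm ?subr_ge0//.
by move: xy; rewrite le_eqVlt => /predU1P[->|->//]; rewrite ltxx subrr.
Qed.

Lemma measurable_layer d (T : measurableType d) (f : T -> R) :
  measurable_fun [set: T] f ->
  measurable_fun [set: T * R] (fun z : T * R => layer (f z.1) z.2).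
Proof.
move=> mf; have mE : measurable [set z : T * R | (z.2 <= f z.1)%R].
  have := @measurable_fun_ler _ (T * R)%type R setT snd (f \o fst) measurable_snd
    (measurableT_comp mf measurable_fst).
  by move=> /(_ measurableT [set true] I); rewrite setTI preimage_true.
rewrite (_ : (fun z => _) = \1_[set z : T * R | (z.2 <= f z.1)%R]).
  exact: measurable_indic.
by apply/funext => z; rewrite indicE mem_setE.
Qed.

Lemma measurable_layer_at s : measurable_fun [set: R] (layer ^~ s).
Proof.
rewrite (_ : layer ^~ s = \1_(`[s, +oo[%classic : set R)).
  exact: measurable_indic.
by apply/funext => y; rewrite /layer indicE mem_setE/= in_itv/= andbT.
Qed.

End layer_cake.

Section tail_distance.
Context (R : realType).
Implicit Types (m p : probability R R) (s u x y : R).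

(** The ray is closed at [s], which makes the tail left-continuous and [le_quantile] an exact
    equivalence. *)
Definition tail m s : R := fine (m `[s, +oo[%classic).

Definition tail_distance m p : \bar R :=
  (\int[lebesgue_measure]_s `|tail m s - tail p s|%:E)%E.

Lemma tailE m s : m `[s, +oo[%classic = (tail m s)%:E.
Proof. by rewrite fineK// fin_num_measure. Qed.

Lemma tail_ge0 m s : 0 <= tail m s.
Proof. exact: fine_ge0. Qed.

Lemma tail_le1 m s : tail m s <= 1.
Proof. by rewrite -lee_fin -tailE; exact: probability_le1. Qed.

Lemma tail_nonincreasing m : {homo tail m : s u /~ s <= u}.
Proof.
move=> s u su; rewrite -lee_fin -!tailE; apply: le_measure; rewrite ?inE//.
by apply: subset_itvr; rewrite bnd_simp.
Qed.

Lemma measurable_tail m : measurable_fun [set: R] (tail m).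
Proof.
apply: nonincreasing_measurable => // s u; exact: tail_nonincreasing.
Qed.

Lemma measurable_tail_diff m p :
  measurable_fun [set: R] (fun s => `|tail m s - tail p s|).
Proof.
by apply: measurableT_comp => //; apply: measurable_funB; exact: measurable_tail.
Qed.

Lemma integral_layer_tail m s : \int[m]_y layer y s = tail m s.
Proof.
rewrite /Rintegral /tail -(setIT `[s, +oo[%classic) -integral_indic//.
congr fine; apply: eq_integral => y _.
by rewrite /layer indicE mem_setE/= in_itv/= andbT.
Qed.

End tail_distance.

(** * Test functions obtained as primitives *)

Section compactly_supported_integrand.
Context (R : realType) (g : R -> R) (c : R).
Hypothesis mg : measurable_fun [set: R] g.
Hypothesis g1 : forall s, `|g s| <= 1.
Hypothesis g0 : forall s, ~~ (0 <= s <= c) -> g s = 0.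
Implicit Types (m p : probability R R) (s u x y : R).

Lemma compact_dominated (f : R -> R) : measurable_fun [set: R] f ->
  (forall s, `|f s| <= `|g s|) ->
  lebesgue_measure.-integrable [set: R] (EFin \o f).
Proof.
move=> mf fg.
have -> : EFin \o f = (EFin \o f) \_ `[0, c].
  apply/funext => s; rewrite patchE mem_setE/= in_itv/=; case: ifPn => // sc.
  by have := fg s; rewrite (g0 sc) normr0 normr_le0 => /eqP/= ->.
apply/(@integrable_mkcond _ _ _ lebesgue_measure `[0, c] (EFin \o f) _) => //.
apply: measurable_bounded_integrable => //.
- by rewrite /= lebesgue_measure_itv/=; case: ifP => _; rewrite ltry.
- exact: measurable_funS mf.
exists 1; split => // M M1 s _; apply: le_trans (ltW M1).
exact: le_trans (fg s) (g1 s).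
Qed.

Lemma compact_integrable : lebesgue_measure.-integrable [set: R] (EFin \o g).
Proof. by apply: compact_dominated. Qed.

Definition primitive y : R := \int[lebesgue_measure]_(s in `]-oo, y]) g s.

(** Integrability of [g] bounds the primitive, [|g| <= 1] makes it 1-Lipschitz, and continuity of
    [g] gives the derivative. *)
Lemma primitive_test_function L : lipschitz_with L g ->
  test_function L primitive /\ derive1 primitive = g.
Proof.
move=> gL; have gcont := lipschitz_with_continuous gL.
have FTC y : derivable primitive y 1 /\ derive1 primitive y = g y.
  apply: (@continuous_FTC1 _ g -oo%O y (y + 1)) => //.
  - by rewrite ltrDl.
  - exact: integrableS compact_integrable.
  - by rewrite ltNyr.
  - exact: gcont.
have dE : derive1 primitive = g by apply/funext => y; have [] := FTC y.
split => //; split; last by rewrite dE.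
- split.
  + by move=> x; have [] := FTC x.
  + by rewrite dE.
  + exists (\int[lebesgue_measure]_s `|g s|) => y.
    apply: le_trans (le_normr_Rintegral _ _) _ => //.
      exact: integrableS compact_integrable.
    rewrite Rintegral_mkcond; apply: le_Rintegral => //.
    * apply: compact_dominated.
        apply/(measurable_restrictT _ _).1 => //; apply: measurable_funTS.
        exact: measurableT_comp.
      by move=> s; rewrite patchE; case: ifP; rewrite ?normr0 ?normr_id.
    * apply: compact_dominated; first exact: measurableT_comp.
      by move=> s; rewrite normr_id.
    * by move=> s _; rewrite patchE; case: ifP => _; [exact: lexx|exact: normr_ge0].
  + by exists 1 => x; rewrite dE.
- apply: derivable_lipschitz_with; first by move=> x; have [] := FTC x.
  by move=> x; rewrite dE.
Qed.

(** Fubini for [g s * layer y s]: integrating in [s] first gives the primitive, in [y] first the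
    tail. *)
Lemma primitive_tail m :
  \int[m]_y primitive y = \int[lebesgue_measure]_s (g s * tail m s).
Proof.
pose f (z : R * R) : \bar R := (g z.2 * layer z.1 z.2)%:E.
have mf : measurable_fun [set: R * R] f.
  apply/measurable_EFinP; apply: measurable_funM.
    exact: measurableT_comp.
  exact: (measurable_layer (@measurable_id _ R setT)).
have fint : (m \x lebesgue_measure)%E.-integrable [set: R * R] f.
  apply/integrable12ltyP => //.
  apply: (@le_lt_trans _ _ (\int[m]_y \int[lebesgue_measure]_s `|(g s)%:E|)%E).
    apply: ge0_le_integral => //.
    - by move=> y _; exact: integral_ge0.
    - apply: (measurable_fun_fubini_tonelli_F (m2 := lebesgue_measure)
        (abse \o f)) => //=.
      exact: measurableT_comp.
    move=> y _; apply: ge0_le_integral => //.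
    - apply: measurableT_comp => //.
      apply: (measurableT_comp mf); exact: measurable_pair1.
    - by apply: measurableT_comp => //; exact/measurable_EFinP.
    move=> s _; rewrite /f/= lee_fin normrM ler_piMr// /layer.
    by case: (s <= y); rewrite ?normr0 ?normr1.
  rewrite integral_cst// [X in (_ * X)%E](_ : _ = 1%E) ?mule1; last first.
    exact: probability_setT.
  by have /integrableP[] := compact_integrable.
transitivity (fine (\int[m]_y \int[lebesgue_measure]_s f (y, s))%E).
  rewrite /Rintegral; congr fine; apply: eq_integral => y _.
  rewrite /primitive Rintegral_mkcond /Rintegral fineK; last first.
    apply: integrable_fin_num => //; apply: compact_dominated.
      by apply/(measurable_restrictT _ _).1 => //; apply: measurable_funTS.
    by move=> s; rewrite patchE; case: ifP; rewrite ?normr0.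
  apply: eq_integral => s _; rewrite /f/= /layer patchE mem_setE/= in_itv/=.
  by case: ifP; rewrite ?mulr1 ?mulr0.
rewrite Fubini//; congr fine; apply: eq_integral => s _.
have ii : m.-integrable [set: R] (EFin \o (fun y => layer y (s : R))).
  apply: (integrable_carried (M := 1) (A := [set: R])).
  - by split => //; exact: probability_setT.
  - exact: measurable_layer_at.
  - by move=> y _; rewrite /layer; case: (s <= y); rewrite ?normr0 ?normr1.
rewrite /f/= -integral_layer_tail -RintegralZl// /Rintegral fineK//.
by apply: integrable_fin_num => //; exact: integrable_realZ.
Qed.

End compactly_supported_integrand.

(** * Lipschitz approximation of the sign of a difference of tails *)

Section duality.
Context (R : realType).
Implicit Types (m p : probability R R) (b s u x y N : R).

(** For [N > 0], a continuous majorant of the indicator of [[0, +oo[] that rises from 0 to 1 on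
    [[- 1 / N, 0]]. *)
Definition ramp N u : R := clip 0 1 (1 + N * u).

Lemma ramp_itv N u : 0 <= ramp N u <= 1.
Proof. exact: clip_itv. Qed.

Lemma ramp_norm N u : `|ramp N u| <= 1.
Proof. by have /andP[r0 r1] := ramp_itv N u; rewrite ger0_norm. Qed.

Lemma ramp_dist N u v : 0 <= N -> `|ramp N u - ramp N v| <= N * `|u - v|.
Proof.
move=> N0; apply: le_trans (clip_dist _ _ ler01) _.
rewrite (_ : _ - _ = N * (u - v)); last by ring.
by rewrite normrM (ger0_norm N0).
Qed.

Lemma ramp_nonneg N u : 0 <= N -> 0 <= u -> ramp N u = 1.
Proof. by move=> N0 u0; apply: clip_hi => //; rewrite lerDl mulr_ge0. Qed.

Lemma ramp_below N u : N * u <= - 1 -> ramp N u = 0.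
Proof. by move=> Nu; apply: clip_lo => //; lra. Qed.

Lemma continuous_ramp N : 0 <= N -> continuous (ramp N).
Proof.
by move=> N0; apply: (@lipschitz_with_continuous _ N) => u v; exact: ramp_dist.
Qed.

Definition smooth_tail m N s : R := \int[m]_y ramp N (y - s).

Lemma measurable_ramp N s : 0 <= N ->
  measurable_fun [set: R] (fun y => ramp N (y - s)).
Proof.
move=> N0; apply: measurableT_comp; last exact: measurable_funB.
by apply: continuous_measurable_fun; exact: continuous_ramp.
Qed.

Lemma carried_by_probability m : carried_by m [set: R].
Proof. by split => //; exact: probability_setT. Qed.

Lemma integrable_ramp m N s : 0 <= N ->
  m.-integrable [set: R] (EFin \o (fun y => ramp N (y - s))).
Proof.
move=> N0; apply: (integrable_carried (M := 1) (carried_by_probability m)).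
  exact: measurable_ramp.
by move=> y _; exact: ramp_norm.
Qed.

Lemma smooth_tail_dist m N s u : 0 <= N ->
  `|smooth_tail m N s - smooth_tail m N u| <= N * `|s - u|.
Proof.
move=> N0; apply: (Rintegral_carried_close (carried_by_probability m)).
- exact: integrable_ramp.
- exact: integrable_ramp.
- move=> y _; apply: le_trans (ramp_dist _ _ N0) _.
  by rewrite (_ : _ - _ - _ = u - s) 1?distrC//; ring.
Qed.

Lemma smooth_tail_const m N s b (r : R) : 0 <= N -> carried_by m `[0, b] ->
  (forall y, 0 <= y <= b -> ramp N (y - s) = r) -> smooth_tail m N s = r.
Proof.
move=> N0 cm rE; rewrite /smooth_tail.
rewrite (Rintegral_carried cm); last exact: integrable_ramp.
rewrite -[RHS](Rintegral_carried_cst r cm).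
rewrite [RHS](Rintegral_carried cm); last exact: (integrable_carried_cst r cm).
by apply: eq_Rintegral => y; rewrite inE/= in_itv/=; exact: rE.
Qed.

Lemma smooth_tail_cvg m s : smooth_tail m n.+1%:R s @[n --> \oo] --> tail m s.
Proof.
rewrite -integral_layer_tail /smooth_tail.
have ii : m.-integrable [set: R] (EFin \o cst 1).
  exact: (integrable_carried_cst 1 (carried_by_probability m)).
have [] := @dominated_convergence _ _ _ m [set: R] measurableT
  (fun n y => (ramp n.+1%:R (y - s))%:E) (fun y => (layer y s)%:E) (EFin \o cst 1).
- by move=> n; apply/measurable_EFinP; exact: measurable_ramp.
- apply/measurable_EFinP; exact: measurable_layer_at.
- apply: aeW => y _; apply: cvg_EFin; first by near=> n.
  rewrite /layer; have [sy|ys] := leP s y.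
    by apply: cvg_near_cst; near=> n; rewrite /= ramp_nonneg ?subr_ge0.
  apply: cvg_near_cst; near=> n.
  rewrite /= ramp_below// -[y - s]opprB mulrN lerN2 -ler_pdivrMr ?subr_gt0//.
  near: n.
  have [k hk] : exists k : nat, 1 / (s - y) <= k%:R.
    by exists (Num.trunc (1 / (s - y))).+1; apply: ltW; exact: truncnS_gt.
  exists k => // n /= kn; apply: le_trans hk _; rewrite ler_nat.
  exact: leq_trans kn (leqnSn n).
- exact: ii.
- by apply: aeW => y n _ /=; rewrite lee_fin ramp_norm.
move=> si _ h; apply: fine_cvg; rewrite fineK//; exact: integrable_fin_num.
Unshelve. all: by end_near. Qed.

(** The sign of [tail m - tail p] is the optimal dual derivative, but it is discontinuous in
    general; smoothing the tails and clipping a large multiple of their difference makes it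
    Lipschitz. *)
Definition sign_test m p N s : R :=
  clip (- 1) 1 (N * (smooth_tail m N s - smooth_tail p N s)).

Lemma sign_test_norm m p N s : `|sign_test m p N s| <= 1.
Proof. by rewrite ler_norml; apply: clip_itv; lra. Qed.

Lemma sign_test_lipschitz m p N : 0 <= N ->
  lipschitz_with (N * (N + N)) (sign_test m p N).
Proof.
move=> N0 s u; have N11 : -1 <= 1 :> R by lra.
apply: le_trans (clip_dist _ _ N11) _.
rewrite -mulrBr normrM (ger0_norm N0) -mulrA ler_wpM2l//.
rewrite (_ : _ - _ = (smooth_tail m N s - smooth_tail m N u) -
  (smooth_tail p N s - smooth_tail p N u)); last by ring.
apply: le_trans (ler_normB _ _) _.
by rewrite mulrDl lerD// smooth_tail_dist.
Qed.

(** Left of 0 both smoothed tails are 1. The ramp has width [1 / N <= 1], so beyond [b + 1] both are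
    0. *)
Lemma sign_test_support m p N s b :
  carried_by m `[0, b] -> carried_by p `[0, b] -> 1 <= N ->
  ~~ (0 <= s <= b + 1) -> sign_test m p N s = 0.
Proof.
move=> cm cp N1; have N0 : 0 <= N by lra.
rewrite /sign_test => hs.
have [r rE] : exists r, forall y, 0 <= y <= b -> ramp N (y - s) = r.
  move: hs; rewrite negb_and -!ltNge => /orP[s0|bs].
    by exists 1 => y /andP[y0 _]; apply: ramp_nonneg => //; lra.
  exists 0 => y /andP[_ yb]; apply: ramp_below.
  by rewrite (@le_trans _ _ (y - s))//; [nra|lra].
rewrite (smooth_tail_const N0 cm rE) (smooth_tail_const N0 cp rE) subrr mulr0.
by rewrite /clip /Num.min /Num.max; case: (ltP (-1)) => ?; case: ltP => ?; lra.
Qed.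

(** [d] has the sign of [T] and at least half its size, so [N * d] lies beyond the clipping level on
    the correct side. *)
Lemma clip_sign (T d N : R) : 0 <= N -> `|T - d| <= `|T| / 2 ->
  1 <= N * (`|T| / 2) -> clip (- 1) 1 (N * d) * T = `|T|.
Proof.
move=> N0 Td NT; have N11 : -1 <= 1 :> R by lra.
have [Tp|Tn] := leP 0 T.
  move: NT Td; rewrite (ger0_norm Tp) ler_norml => NT /andP[Td1 Td2].
  rewrite clip_hi ?mul1r//; apply: le_trans NT _; rewrite ler_wpM2l//; lra.
move: NT Td; rewrite (ltr0_norm Tn) ler_norml => NT /andP[Td1 Td2].
rewrite clip_lo ?mulN1r// lerNr -mulrN; apply: le_trans NT _.
rewrite ler_wpM2l//; lra.
Qed.

Lemma sign_test_cvg m p s :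
  sign_test m p n.+1%:R s * (tail m s - tail p s) @[n --> \oo] -->
  `|tail m s - tail p s|.
Proof.
(* Where the tails agree [sign_test] may fail to converge; the factor that multiplies it is 0
   there. *)
have [->|T0] := eqVneq (tail m s - tail p s) 0.
  by rewrite normr0; under eq_fun do rewrite mulr0; exact: cvg_cst.
set T := tail m s - tail p s in T0 *.
have dT : smooth_tail m n.+1%:R s - smooth_tail p n.+1%:R s @[n --> \oo] --> T.
  by apply: cvgB; exact: smooth_tail_cvg.
have T20 : 0 < `|T| / 2 by rewrite divr_gt0// normr_gt0.
have N11 : -1 <= 1 :> R by lra.
apply: cvg_near_cst; near=> n.
have dn : `|T - (smooth_tail m n.+1%:R s - smooth_tail p n.+1%:R s)| <= `|T| / 2.
  by near: n; exact: cvgr_dist_le dT _ T20.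
have nT : 1 <= n.+1%:R * (`|T| / 2).
  rewrite -ler_pdivrMr//; near: n.
  have [k hk] : exists k : nat, 1 / (`|T| / 2) <= k%:R.
    by exists (Num.trunc (1 / (`|T| / 2))).+1; apply: ltW; exact: truncnS_gt.
  exists k => // n /= kn; apply: le_trans hk _; rewrite ler_nat.
  exact: leq_trans kn (leqnSn n).
exact: clip_sign.
Unshelve. all: by end_near. Qed.

(** Testing with the primitive of [g n] bounds the integral of [g n * T] by [r], and dominated
    convergence turns this integral into that of [|T|], all [g n] vanishing off [[0, b + 1]]. *)
Lemma tail_distance_le m p b (r : R) :
  carried_by m `[0, b] -> carried_by p `[0, b] ->
  (forall L f, test_function L f -> `|\int[m]_y f y - \int[p]_y f y| <= r) ->
  (tail_distance m p <= r%:E)%E.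
Proof.
move=> cm cp testr.
pose T s := tail m s - tail p s.
have mT : measurable_fun [set: R] T.
  by apply: measurable_funB; exact: measurable_tail.
have T1 s : `|T s| <= 1.
  have := tail_ge0 m s; have := tail_ge0 p s.
  by have := tail_le1 m s; have := tail_le1 p s; rewrite ler_norml /T; lra.
pose g n := sign_test m p n.+1%:R.
have gl n := sign_test_lipschitz m p (ler0n R n.+1).
have mg n : measurable_fun [set: R] (g n) := lipschitz_with_measurable (gl n).
have g1 n s : `|g n s| <= 1 by exact: sign_test_norm.
have gb n s : ~~ (0 <= s <= b + 1) -> g n s = 0.
  by apply: (sign_test_support cm cp); rewrite ler1n.
have gTi n (q : probability R R) :
    lebesgue_measure.-integrable [set: R] (EFin \o (fun s => g n s * tail q s)).
  apply: (compact_dominated (g1 n) (gb n)).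
    by apply: measurable_funM => //; exact: measurable_tail.
  move=> s; rewrite normrM ler_piMr// ger0_norm ?tail_le1//; exact: tail_ge0.
have le_r n : (\int[lebesgue_measure]_s (g n s * T s)%:E <= r%:E)%E.
  have [ft _] := primitive_test_function (mg n) (g1 n) (gb n) (gl n).
  have := testr _ _ ft; rewrite !(primitive_tail (mg n) (g1 n) (gb n)).
  rewrite -RintegralB// => /(le_trans (ler_norm _)).
  have TE : (fun s => g n s * tail m s - g n s * tail p s) = (fun s => g n s * T s).
    by apply/funext => s; rewrite -mulrBr.
  rewrite TE -lee_fin /Rintegral fineK//.
  apply: integrable_fin_num => //.
  by have := integrable_realB measurableT (gTi n m) (gTi n p); rewrite TE.
have [] := @dominated_convergence _ _ _ lebesgue_measure [set: R] measurableT
  (fun n s => (g n s * T s)%:E) (fun s => `|T s|%:E)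
  (EFin \o \1_(`[0, b + 1]%classic)).
- by move=> n; apply/measurable_EFinP; exact: (measurable_funM (mg n) mT).
- by apply/measurable_EFinP; exact: measurable_tail_diff.
- by apply: aeW => s _; apply: cvg_EFin; [near=> n|exact: (@sign_test_cvg m p s)].
- apply/integrable_indic_itv => //.
- apply: aeW => s n _ /=; rewrite lee_fin indicE mem_setE/= in_itv/=.
  have [sb|sb] := boolP (0 <= s <= b + 1); last by rewrite gb// mul0r normr0.
  by rewrite normrM mulr_ile1.
move=> _ _ h; rewrite /tail_distance -(cvg_lim _ h)//.
apply: lime_le; first by apply/cvg_ex; eexists; exact: h.
by near=> n; exact: le_r.
Unshelve. all: by end_near. Qed.

End duality.

(** * Quantile coupling *)

Section uniform_law.
Context (R : realType).
Implicit Types (t : R).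

(* [uniform_prob] lives on the display of [lebesgue_measure]; [uniform01] is the
   same set function on the canonical measurable structure of [R]. *)
Definition uniform01 : set R -> \bar R := uniform_prob (@ltr01 R).

Let uniform01_0 : uniform01 set0 = 0%E.
Proof. exact: measure0. Qed.

Let uniform01_ge0 A : (0 <= uniform01 A)%E.
Proof. exact: measure_ge0. Qed.

Let uniform01_sigma_additive : semi_sigma_additive uniform01.
Proof. exact: (@measure_semi_sigma_additive _ _ _ (uniform_prob (@ltr01 R))). Qed.

HB.instance Definition _ := isMeasure.Build _ _ _ uniform01
  uniform01_0 uniform01_ge0 uniform01_sigma_additive.

Let uniform01_setT : uniform01 [set: R] = 1%E.
Proof. exact: (@probability_setT _ _ _ (uniform_prob (@ltr01 R))). Qed.

HB.instance Definition _ :=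
  Measure_isProbability.Build _ _ _ uniform01 uniform01_setT.

Lemma uniform01_le t : 0 <= t <= 1 -> uniform01 `]-oo, t]%classic = t%:E.
Proof.
move=> /andP[t0 t1].
have mA : measurable (`]-oo, t]%classic : set R) by exact: measurable_itv.
have -> : uniform01 `]-oo, t]%classic =
    (\int[uniform_prob (@ltr01 R)]_x (\1_(`]-oo, t]%classic) x)%:E)%E.
  by rewrite integral_indic// setIT.
rewrite integral_uniform//; last by apply/measurable_EFinP; exact: measurable_indic.
rewrite subr0 invr1 mul1e integral_indic//.
rewrite (_ : _ `&` _ = `[0, t]%classic).
  rewrite /= lebesgue_measure_itv/= lte_fin; case: ltgtP t0 => // [_ _|<- _//].
  by rewrite oppr0 adde0.
apply/seteqP; split => x /=; rewrite !in_itv/=; lra.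
Qed.

(** The point 0 is left out because [u <= tail m s] holds for every [s] when [u = 0], so that no
    quantile exists there. *)
Lemma carried_by_uniform01 : carried_by uniform01 `]0, 1].
Proof.
have u0 : uniform01 `]-oo, 0%R]%classic = 0%E by rewrite uniform01_le ?lexx ?ler01.
have u1 : uniform01 `]-oo, 1%R]%classic = 1%E by rewrite uniform01_le ?lexx ?ler01.
split => //.
apply/le_anti/andP; split; first exact: probability_le1.
rewrite -[leLHS]u1 -[leRHS]add0e -[X in (_ <= X + _)%E]u0.
apply: le_trans (measureU2 _ _ _) => //.
apply: le_measure; rewrite ?inE//; first exact: measurableU.
move=> x /=; rewrite !in_itv/= => x1.
by have [x0|x0] := leP x 0; [left|right].
Qed.

Lemma carried_by_ext (m : {measure set R -> \bar R}) (A B C : set R) :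
  carried_by m A -> measurable B -> measurable C -> B `&` A = C `&` A ->
  m B = m C.
Proof.
move=> cA mB mC BC; have [mA _ _] := cA.
have main D : measurable D -> m D = m (D `&` A).
  move=> mD; have mDA : measurable (D `&` A) by exact: measurableI.
  apply/le_anti/andP; split; last by apply: le_measure; rewrite ?inE.
  rewrite -[leRHS]adde0 -(carried_by_setC cA).
  apply: le_trans (measureU2 _ _ _) => //; last exact: measurableC.
  apply: le_measure; rewrite ?inE//; first by apply: measurableU => //; exact: measurableC.
  by move=> x Dx; have [Ax|Ax] := pselect (A x); [left|right].
by rewrite (main B)// (main C)// BC.
Qed.

End uniform_law.

(** * Quantile function of a law on the half-line *)

Section quantile.
Context (R : realType) (m : probability R R).
Hypothesis cm : carried_by m `[0, +oo[.
Implicit Types (s u : R).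

(** Inverse of the nonincreasing [tail m], thus a quantile counted from the top. The value 0 off
    []0, 1]] is a default on a null set of [uniform01]. *)
Definition quantile u : R :=
  if (0 < u) && (u <= 1) then sup [set s | u <= tail m s] else 0.

Lemma tail_0 : tail m 0 = 1.
Proof. by apply/EFin_inj; rewrite -tailE; case: cm. Qed.

Lemma tail_lt u : 0 < u -> exists s, tail m s < u.
Proof.
move=> u0; pose F (n : nat) := `[n%:R, +oo[%classic : set R.
have F0 : \bigcap_n F n = set0.
  apply/seteqP; split => // x /(_ (Num.trunc x).+1 I); rewrite /F/= in_itv/= andbT.
  by rewrite leNgt truncnS_gt.
have : (m \o F) n @[n --> \oo] --> m (\bigcap_n F n).
  apply: nonincreasing_cvg_mu.
  - by apply: le_lt_trans (probability_le1 m (measurable_itv _)) _; rewrite ltry.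
  - by move=> n; exact: measurable_itv.
  - by rewrite F0.
  - move=> i j ij; apply/subsetPset; apply: subset_itvr.
    by rewrite bnd_simp ler_nat.
rewrite F0 measure0 => /fine_cvgP[_ /cvgrPdist_lt/(_ _ u0)[n _ /(_ n (leqnn n))]].
rewrite /= sub0r normrN => h; exists n%:R; apply: le_lt_trans h.
exact: ler_norm.
Qed.

(** Left continuity of the tail: [[s, +oo[] is the decreasing intersection of the rays that start at
    [s - 1 / n.+1]. *)
Lemma tail_left_limit s u : (forall y, y < s -> u <= tail m y) -> u <= tail m s.
Proof.
move=> us; pose F (n : nat) := `[s - n.+1%:R^-1, +oo[%classic : set R.
have F0 : \bigcap_n F n = `[s, +oo[%classic.
  apply/seteqP; split => x /=; rewrite ?in_itv/= ?andbT.
    move=> h; apply/ler_addgt0Pr => e e0.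
    have [n ne] : exists n : nat, n.+1%:R^-1 <= e.
      exists (Num.trunc e^-1); rewrite -[leRHS]invrK lef_pV2 ?posrE ?invr_gt0//.
      by apply: ltW; exact: truncnS_gt.
    have := h n I; rewrite /F/= in_itv/= andbT lerBlDr => /le_trans; apply.
    by rewrite lerD2l.
  move=> sx n _; rewrite /F/= in_itv/= andbT (le_trans _ sx)// gerBl.
  by rewrite invr_ge0.
have : (m \o F) n @[n --> \oo] --> m (\bigcap_n F n).
  apply: nonincreasing_cvg_mu.
  - by apply: le_lt_trans (probability_le1 m (measurable_itv _)) _; rewrite ltry.
  - by move=> n; exact: measurable_itv.
  - by rewrite F0; exact: measurable_itv.
  - move=> i j ij; apply/subsetPset; apply: subset_itvr.
    by rewrite bnd_simp lerD2l lerN2 lef_pV2 ?posrE// ler_nat.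
rewrite F0 => h; rewrite -lee_fin -tailE -(cvg_lim _ h)//.
apply: lime_ge; first by apply/cvg_ex; eexists; exact: h.
near=> n; rewrite /= /F tailE lee_fin; apply: us.
by rewrite ltrBlDr ltrDl invr_gt0.
Unshelve. all: by end_near. Qed.

(** The defining set is closed downwards, and left continuity of the tail puts its supremum in
    it. *)
Lemma le_quantile s u : 0 < u -> u <= 1 -> (s <= quantile u) = (u <= tail m s).
Proof.
move=> u0 u1; rewrite /quantile u0 u1/=.
set E := [set s | _].
have hE : has_sup E.
  split; first by exists 0; rewrite /E/= tail_0.
  have [z zu] := tail_lt u0; exists z => x /= ux; rewrite leNgt; apply/negP => zx.
  have := le_lt_trans (le_trans ux (tail_nonincreasing m (ltW zx))) zu.
  by rewrite ltxx.
apply/idP/idP => [sE|us]; last by apply: ub_le_sup => //; case: hE.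
apply: tail_left_limit => y ys.
have [x Ex yx] := sup_gt hE.1 (lt_le_trans ys sE).
exact: le_trans Ex (tail_nonincreasing m (ltW yx)).
Qed.

Lemma measurable_quantile_ge s : measurable [set u | s <= quantile u].
Proof.
(* Off []0, 1]] the quantile is 0, so the condition there is just [s <= 0]. *)
rewrite (_ : [set u | _] = (`]0, 1] `&` `]-oo, tail m s]) `|`
    (~` `]0, 1] `&` (if s <= 0 then setT else set0))); last first.
  apply/seteqP; split => u /=; rewrite !in_itv/=.
    have [/andP[u0 u1]|u01] := boolP (0 < u <= 1).
      by rewrite le_quantile// => us; left.
    by rewrite /quantile (negbTE u01) => ->; right; split => //; exact/negP.
  case=> [[/andP[u0 u1] us]|[u01]]; first by rewrite le_quantile.
  by move/negP: u01; rewrite /quantile => /negbTE ->; case: ifP.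
apply: measurableU; apply: measurableI => //; first exact: measurableC.
by case: ifP.
Qed.

Lemma measurable_quantile : measurable_fun [set: R] quantile.
Proof.
apply: (measurability _ (RGenCInfty.measurableE R)) => //.
move=> /= _ [_ [x ->] <-]; apply: measurableI => //.
rewrite preimage_itvcy; exact: measurable_quantile_ge.
Qed.

Lemma quantile_law (A : set R) : measurable A ->
  uniform01 (quantile @^-1` A) = m A.
Proof.
(* Rays [[x, +oo[] generate the Borel sets and are stable under intersection, so agreement on them
   determines the law. *)
have tails x : uniform01 (quantile @^-1` `[x, +oo[%classic) = m `[x, +oo[%classic.
  rewrite tailE -uniform01_le ?tail_ge0 ?tail_le1//.
  apply: (carried_by_ext (@carried_by_uniform01 R)) => //.
    by rewrite preimage_itvcy; exact: measurable_quantile_ge.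
  apply/seteqP; split => u /=; rewrite !in_itv/= andbT => -[us /andP[u0 u1]];
    by move: us; rewrite le_quantile// u0 u1.
move=> mA; have mA' : (@RGenCInfty.G R).-sigma.-measurable A.
  by rewrite -RGenCInfty.measurableE.
have mq := measurable_quantile.
pose q : {mfun R >-> R} :=
  HB.pack quantile (isMeasurableFun.Build _ _ _ _ quantile mq).
apply: (@g_sigma_algebra_measure_unique _ _ _ (@RGenCInfty.G R) _
  (fun n => `[- n%:R, +oo[%classic) _ _ (distribution (@uniform01 R) q) m) => //.
- by move=> _ [x ->]; exact: measurable_itv.
- by move=> n; eexists.
- apply/seteqP; split => // x _; exists (Num.trunc (- x)).+1 => //=.
  by rewrite in_itv/= andbT lerNl; apply: ltW; exact: truncnS_gt.
- move=> _ _ [x ->] [y ->]; exists (Num.max x y).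
  by apply/seteqP; split => z /=; rewrite !in_itv/= !andbT ge_max => /andP.
- by move=> _ [x ->]; exact: tails.
- move=> n; apply: le_lt_trans (probability_le1 _ (measurable_itv _)) _.
  by rewrite ltry.
Qed.

End quantile.

(** * Cost of the quantile coupling *)

Section quantile_coupling.
Context (R : realType).
Implicit Types (m p : probability R R) (s t u : R).

Lemma integrable_layer_uniform t :
  (@uniform01 R).-integrable [set: R] (EFin \o layer t).
Proof.
apply: (integrable_carried (M := 1) (carried_by_probability (@uniform01 R))).
  rewrite (_ : layer t = \1_(`]-oo, t]%classic : set R)).
    exact: measurable_indic.
  by apply/funext => u; rewrite /layer indicE mem_setE/= in_itv.
by move=> u _; rewrite /layer; case: (u <= t); rewrite ?normr0 ?normr1.
Qed.

Lemma uniform01_layer t : 0 <= t <= 1 -> \int[@uniform01 R]_u layer t u = t.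
Proof.
move=> t01; rewrite -[RHS]/(fine t%:E) -(uniform01_le t01).
rewrite -(setIT `]-oo, t]%classic) -integral_indic//.
by congr fine; apply: eq_integral => u _; rewrite /layer indicE mem_setE/= in_itv.
Qed.

Lemma uniform01_layer_dist t t' : 0 <= t <= 1 -> 0 <= t' <= 1 ->
  \int[@uniform01 R]_u `|layer t u - layer t' u| = `|t - t'|.
Proof.
wlog tt' : t t' / t <= t' => [hw|] t01 t01'.
  have [tt'|/ltW t't] := leP t t'; first exact: hw.
  rewrite distrC -hw//; congr fine; apply: eq_integral => u _.
  by rewrite distrC.
rewrite [LHS](_ : _ = \int[@uniform01 R]_u (layer t' u - layer t u)).
  rewrite RintegralB//; [|exact: integrable_layer_uniform..].
  by rewrite !uniform01_layer// distrC ger0_norm// subr_ge0.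
congr fine; apply: eq_integral => u _; rewrite distrC ger0_norm// subr_ge0 /layer.
by have [ut|ut] := leP u t; [rewrite (le_trans ut tt')|case: (u <= t')].
Qed.

(** By [le_quantile] the level and the uniform variable exchange roles: [layer (quantile m u) s]
    equals [layer (tail m s) u] for [u] in []0, 1]]. *)
Lemma uniform01_quantile_layer m p s :
  carried_by m `[0, +oo[ -> carried_by p `[0, +oo[ ->
  (\int[@uniform01 R]_u
     `|layer (quantile m u) s - layer (quantile p u) s|%:E =
   `|tail m s - tail p s|%:E)%E.
Proof.
move=> cm cp.
have cU := @carried_by_uniform01 R.
have mq (q : probability R R) : carried_by q `[0, +oo[ ->
    measurable_fun [set: R] (fun u => layer (quantile q u) s).
  move=> cq; rewrite (_ : (fun u => _) = \1_[set u | s <= quantile q u]).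
    by apply: measurable_indic; exact: measurable_quantile_ge.
  by apply/funext => u; rewrite /layer indicE mem_setE.
have i1 : (@uniform01 R).-integrable [set: R]
    (EFin \o (fun u => `|layer (quantile m u) s - layer (quantile p u) s|)).
  apply: (integrable_carried (M := 1) (carried_by_probability (@uniform01 R))).
    by apply: measurableT_comp => //; apply: measurable_funB; exact: mq.
  move=> u _; rewrite normr_id /layer.
  by case: (s <= quantile m u); case: (s <= quantile p u);
    rewrite ?subrr ?subr0 ?sub0r ?normrN ?normr1 ?normr0.
have i2 : (@uniform01 R).-integrable [set: R]
    (EFin \o (fun u => `|layer (tail m s) u - layer (tail p s) u|)).
  apply: integrable_real_norm => //; apply: integrable_realB => //;
    exact: integrable_layer_uniform.
rewrite -(@uniform01_layer_dist (tail m s) (tail p s)) ?tail_ge0 ?tail_le1//.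
rewrite (Rintegral_carried cU i2) -[LHS]fineK; last exact: integrable_fin_num i1.
congr EFin; rewrite -[LHS]/(Rintegral _ _ _) (Rintegral_carried cU i1).
apply: eq_Rintegral => u; rewrite inE/= in_itv/= => /andP[u0 u1].
by rewrite /layer !le_quantile.
Qed.

(** The image of [uniform01] under both quantile functions at once is a coupling, and by layers and
    Tonelli its cost equals the tail distance. *)
Lemma W1_le_tail_distance m p :
  carried_by m `[0, +oo[ -> carried_by p `[0, +oo[ ->
  (W1 m p <= tail_distance m p)%E.
Proof.
move=> cm cp.
have mqm := measurable_quantile cm; have mqp := measurable_quantile cp.
pose f u := (quantile m u, quantile p u).
have mf : measurable_fun [set: R] f by exact: measurable_fun_pair.
pose q : {mfun R >-> (R * R)%type} := HB.pack f (isMeasurableFun.Build _ _ _ _ f mf).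
pose Pi : probability (R * R)%type R := distribution (@uniform01 R) q.
have cPi : coupling m p Pi.
  by split => A mA; rewrite -(quantile_law _ mA).
apply: (@le_trans _ _ (\int[Pi]_z `|z.1 - z.2|%:E)%E).
  by apply: ereal_inf_lbound; exists Pi.
rewrite ge0_integral_distribution//; last first.
  apply/measurable_EFinP; apply: measurableT_comp => //.
  exact: measurable_funB.
rewrite /=; under eq_integral do rewrite -integral_layer_dist.
pose g (z : R * R) :=
  (`|layer (quantile m z.1) z.2 - layer (quantile p z.1) z.2|%:E : \bar R).
have mg : measurable_fun [set: R * R] g.
  apply/measurable_EFinP; apply: measurableT_comp => //.
  by apply: measurable_funB; exact: measurable_layer.
rewrite [leLHS](_ : _ =
    (\int[lebesgue_measure]_s \int[@uniform01 R]_u g (u, s))%E); last first.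
  apply: (@fubini_tonelli _ _ _ _ _ (@uniform01 R) lebesgue_measure g mg) => z.
  by rewrite lee_fin.
rewrite le_eqVlt; apply/orP; left; apply/eqP.
by apply: eq_integral => s _; exact: uniform01_quantile_layer.
Qed.

End quantile_coupling.

(** * Contraction *)

Section mixtures.
Context (R : realType).
Implicit Types (P Q : R.-pker R ~> R) (alpha beta : probability R R).

(** Tonelli requires measurability jointly in level and starting point, which comes from writing the
    tail as a kernel integral of [layer]. *)
Lemma measurable_kernel_tail P :
  measurable_fun [set: R * R] (fun z : R * R => tail (kernel_law P z.2) z.1).
Proof.
have -> : (fun z : R * R => tail (kernel_law P z.2) z.1) =
    (fun z : R * R => fine (\int[kernel.kernel_snd P z]_w (layer w z.1)%:E)%E).
  apply/funext => z; rewrite /tail -(setIT `[z.1, +oo[%classic) -integral_indic//.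
  congr fine; apply: eq_integral => w _.
  by rewrite /layer indicE mem_setE/= in_itv/= andbT.
apply: measurableT_comp => //.
apply: (measurable_fun_integral_sfinite_kernel
  (fun u : (R * R) * R => (layer u.2 u.1.1)%:E) (kernel.kernel_snd P)).
  by move=> u; rewrite lee_fin /layer.
apply/measurable_EFinP.
have := measurable_layer (@measurable_id _ R setT).
move=> /measurableT_comp h.
apply: (h _ _ _ (fun u : (R * R) * R => (u.2, u.1.1))).
apply: measurable_fun_pair => //.
exact: measurableT_comp.
Qed.

Lemma integral_coupling_fst alpha beta (Pi : probability (R * R)%type R)
    (f : R -> \bar R) : coupling alpha beta Pi ->
  measurable_fun [set: R] f -> (forall y, 0 <= f y)%E ->
  (\int[alpha]_y f y = \int[Pi]_z f z.1)%E.
Proof.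
move=> [Pi1 _] mf f0.
pose p : {mfun (R * R)%type >-> R} :=
  HB.pack (@fst R R) (isMeasurableFun.Build _ _ _ _ _ measurable_fst).
rewrite -[RHS](@ge0_integral_distribution _ _ _ _ _ Pi p f)//.
by apply: eq_measure_integral => A mA _; exact/esym/Pi1.
Qed.

Lemma integral_coupling_snd alpha beta (Pi : probability (R * R)%type R)
    (f : R -> \bar R) : coupling alpha beta Pi ->
  measurable_fun [set: R] f -> (forall y, 0 <= f y)%E ->
  (\int[beta]_y f y = \int[Pi]_z f z.2)%E.
Proof.
move=> [_ Pi2] mf f0.
pose p : {mfun (R * R)%type >-> R} :=
  HB.pack (@snd R R) (isMeasurableFun.Build _ _ _ _ _ measurable_snd).
rewrite -[RHS](@ge0_integral_distribution _ _ _ _ _ Pi p f)//.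
by apply: eq_measure_integral => A mA _; exact/esym/Pi2.
Qed.

Lemma measurable_kernel_tail_at P s :
  measurable_fun [set: R] (fun y => tail (kernel_law P y) s).
Proof. by apply: measurableT_comp => //; exact: measurable_kernel. Qed.

Definition tail_gap P Q (z : R * R) (s : R) : \bar R :=
  `|tail (kernel_law P z.1) s - tail (kernel_law Q z.2) s|%:E.

Lemma measurable_tail_gap P Q :
  measurable_fun [set: (R * R) * R] (fun w => tail_gap P Q w.1 w.2).
Proof.
apply/measurable_EFinP; apply: measurableT_comp => //; apply: measurable_funB.
  apply: (measurableT_comp (measurable_kernel_tail P)
    (_ : measurable_fun _ (fun w : (R * R) * R => (w.2, w.1.1)))).
  by apply: measurable_fun_pair => //; exact: measurableT_comp.
apply: (measurableT_comp (measurable_kernel_tail Q)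
  (_ : measurable_fun _ (fun w : (R * R) * R => (w.2, w.1.2)))).
by apply: measurable_fun_pair => //; exact: measurableT_comp.
Qed.

Lemma measurable_tail_distance P Q : measurable_fun [set: R * R]
  (fun z => tail_distance (kernel_law P z.1) (kernel_law Q z.2)).
Proof.
pose g (w : (R * R) * R) := tail_gap P Q w.1 w.2.
have g0 w : (0 <= g w)%E by rewrite lee_fin.
exact: (@measurable_fun_fubini_tonelli_F _ _ _ _ _ lebesgue_measure g
  (measurable_tail_gap P Q) g0).
Qed.

(** Convexity of the tail distance: the tails of [alpha'] and [beta'] are averages, over the same
    [Pi], of the tails of the two kernels. *)
Lemma tail_distance_coupling P Q alpha beta alpha' beta'
    (Pi : probability (R * R)%type R) : coupling alpha beta Pi ->
  (forall B : set R, measurable B -> alpha' B = (\int[alpha]_y P y B)%E) ->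
  (forall B : set R, measurable B -> beta' B = (\int[beta]_y Q y B)%E) ->
  (tail_distance alpha' beta' <=
   \int[Pi]_z tail_distance (kernel_law P z.1) (kernel_law Q z.2))%E.
Proof.
move=> cPi alphaP betaQ.
pose F (z : R * R) s := tail (kernel_law P z.1) s.
pose G (z : R * R) s := tail (kernel_law Q z.2) s.
have mF s : measurable_fun [set: R * R] (F ^~ s).
  by apply: (measurableT_comp (measurable_kernel_tail_at P s)).
have mG s : measurable_fun [set: R * R] (G ^~ s).
  by apply: (measurableT_comp (measurable_kernel_tail_at Q s)).
have bounded01 (f : R * R -> R) : measurable_fun [set: R * R] f ->
    (forall z, 0 <= f z <= 1) -> Pi.-integrable [set: R * R] (EFin \o f).
  move=> mf f01; apply: measurable_bounded_integrable => //.
    by rewrite [X in (X < _)%E](_ : _ = 1%E) ?ltry//; exact: probability_setT.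
  exists 1; split => // M M1 z _; have /andP[f0 f1] := f01 z.
  by rewrite /= ger0_norm//; exact: le_trans f1 (ltW M1).
have iF s : Pi.-integrable [set: R * R] (EFin \o F ^~ s).
  by apply: bounded01 => // z; rewrite tail_ge0 tail_le1.
have iG s : Pi.-integrable [set: R * R] (EFin \o G ^~ s).
  by apply: bounded01 => // z; rewrite tail_ge0 tail_le1.
have alphaE s : tail alpha' s = \int[Pi]_z F z s.
  rewrite {1}/tail alphaP; last exact: measurable_itv.
  rewrite (integral_coupling_fst cPi)//; last exact: measurable_kernel.
  congr fine; apply: eq_integral => z _; exact: (tailE (kernel_law P z.1) s).
have betaE s : tail beta' s = \int[Pi]_z G z s.
  rewrite {1}/tail betaQ; last exact: measurable_itv.
  rewrite (integral_coupling_snd cPi)//; last exact: measurable_kernel.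
  congr fine; apply: eq_integral => z _; exact: (tailE (kernel_law Q z.2) s).
pose g (w : (R * R) * R) := tail_gap P Q w.1 w.2.
have mg : measurable_fun [set: (R * R) * R] g := measurable_tail_gap P Q.
have g0 w : (0 <= g w)%E by rewrite lee_fin.
rewrite [leRHS](_ : _ = (\int[lebesgue_measure]_s \int[Pi]_z g (z, s))%E); last first.
  exact: (@fubini_tonelli _ _ _ _ _ Pi lebesgue_measure g mg g0).
apply: ge0_le_integral => //.
- by apply/measurable_EFinP; exact: measurable_tail_diff.
- exact: (@measurable_fun_fubini_tonelli_G _ _ _ _ _ Pi g mg g0).
move=> s _; have iFG := integrable_realB measurableT (iF s) (iG s).
rewrite alphaE betaE -RintegralB// EFin_normr_Rintegral//.
by apply: le_abse_integral => //; case/integrableP: iFG.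
Qed.

Lemma tail_distance_mixture P Q alpha beta alpha' beta' (A : set R) (c e : R) :
  measurable A -> alpha A = 1%E -> beta A = 1%E -> 0 < c -> 0 <= e ->
  (forall B : set R, measurable B -> alpha' B = (\int[alpha]_y P y B)%E) ->
  (forall B : set R, measurable B -> beta' B = (\int[beta]_y Q y B)%E) ->
  (forall y y', A y -> A y' ->
    (tail_distance (kernel_law P y) (kernel_law Q y') <=
     (c * `|y - y'| + e)%:E)%E) ->
  (tail_distance alpha' beta' <= c%:E * W1 alpha beta + e%:E)%E.
Proof.
move=> mA alphaA betaA c0 e0 alphaP betaQ PQ.
(* Dividing by [c > 0] isolates the infimum, so that a single coupling [Pi] has to be treated. *)
rewrite -leeBlDr// -lee_pdivrMl//; apply: le_ereal_inf_tmp => _ [Pi cPi <-].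
rewrite lee_pdivrMl// leeBlDr//.
apply: le_trans (tail_distance_coupling cPi alphaP betaQ) _.
have mdist : measurable_fun [set: R * R] (fun z : R * R => `|z.1 - z.2|%:E).
  apply/measurable_EFinP; apply: measurableT_comp => //; exact: measurable_funB.
have null (i : R * R -> R) (m : probability R R) : measurable_fun [set: R * R] i ->
    (forall B : set R, measurable B -> Pi (i @^-1` B) = m B) -> m A = 1%E ->
    Pi.-negligible (i @^-1` (~` A)).
  move=> mi Pim mA1; apply/negligibleP.
    by rewrite -[X in measurable X]setTI; apply: mi => //; exact: measurableC.
  apply: etrans (Pim _ (measurableC mA)) _.
  by apply: carried_by_setC; split => //; exact: probability_setT.
apply: (@le_trans _ _ (\int[Pi]_z (c%:E * `|z.1 - z.2|%:E + e%:E))%E).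
  apply: ae_ge0_le_integral => //.
  - by move=> z _; exact: integral_ge0.
  - exact: measurable_tail_distance.
  - by move=> z _; rewrite adde_ge0// ?mule_ge0// lee_fin ltW.
  - by apply: emeasurable_funD => //; exact: measurable_funeM.
  have [cPi1 cPi2] := cPi.
  apply: (negligibleS _ (negligibleU (null fst alpha measurable_fst cPi1 alphaA)
    (null snd beta measurable_snd cPi2 betaA))).
  move=> z /= hz; apply: contrapT => /not_orP[/contrapT Az1 /contrapT Az2].
  by apply: hz => _; rewrite -EFinM -EFinD; exact: PQ.
rewrite ge0_integralD//.
- rewrite ge0_integralZl//; last by rewrite lee_fin ltW.
  apply: leeD2l; rewrite integral_cst//.
  by rewrite [X in (_ * X)%E](_ : _ = 1%E) ?mule1//; exact: probability_setT.
- by move=> z _; rewrite mule_ge0// lee_fin ltW.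
- exact: measurable_funeM.
Qed.

End mixtures.

Lemma carried_by_kernel_law (R : realType) (k : R.-pker R ~> R) x A :
  carried_by (k x) A -> carried_by (kernel_law k x) A.
Proof. by case=> mA k1 kA; split. Qed.

(** * Iteration in time *)

Section contraction.
Context (R : realType) (H : probability R R) (a : R).
Hypothesis H01 : H `[0, 1[%classic = 1%E.
Hypothesis a_gt0 : 0 < a.
Context (P Q : R -> R.-pker R ~> R).
Hypothesis P_La : semigroup_La H a P.
Hypothesis Q_La : semigroup_La H a Q.
Implicit Types (b e t x y : R).

Local Notation rate := (a * kappa1 H).

Lemma rate_ge0 : 0 <= rate.
Proof. by rewrite mulr_ge0 ?(kappa1_ge0 H01)// ltW. Qed.

Lemma short_time_tail_contraction b x y e : 0 <= x <= b -> 0 <= y <= b ->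
  0 <= e <= 1 -> e * (b + a) <= 1 ->
  (tail_distance (kernel_law (P e) x) (kernel_law (Q e) y) <=
   (expR (- (rate * e)) * `|x - y| + contraction_constant a b * e ^+ 2)%:E)%E.
Proof.
move=> xb yb e01 eb; apply: (@tail_distance_le _ _ _ (b + 3)).
- apply: carried_by_kernel_law; exact: (carried_by_short H01 a_gt0 P_La xb e01).
- apply: carried_by_kernel_law; exact: (carried_by_short H01 a_gt0 Q_La yb e01).
move=> L f Lf; exact: (short_time_contraction H01 a_gt0 P_La Q_La Lf).
Qed.

(** The quantile coupling turns the tail bound at one time into a bound on [W1], from which
    [tail_distance_mixture] makes the tail bound one step later. Up to time [t] both laws stay in
    [[0, b]], so one constant serves for all steps. *)
Lemma iterated_tail_contraction b t x y e n : 0 <= x -> 0 <= y ->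
  x + 3 * t <= b -> y + 3 * t <= b -> 0 < e -> e <= 1 -> e * (b + a) <= 1 ->
  n.+1%:R * e <= t ->
  (tail_distance (kernel_law (P (n.+1%:R * e)) x) (kernel_law (Q (n.+1%:R * e)) y) <=
   (expR (- (rate * (n.+1%:R * e))) * `|x - y| +
    n.+1%:R * (contraction_constant a b * e ^+ 2))%:E)%E.
Proof.
move=> x0 y0 xb yb e0 e1 eb; have e01 : 0 <= e <= 1 by rewrite ltW.
elim: n => [|n IH] nt.
  rewrite !mul1r in nt *.
  by apply: short_time_tail_contraction => //; lra.
set s := n.+1%:R * e in IH.
have s0 : 0 <= s by rewrite mulr_ge0// ltW.
have sS : n.+2%:R * e = s + e by rewrite -[n.+2]addn1 natrD mulrDl mul1r.
rewrite sS in nt *.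
have st : s <= t by lra.
set C := contraction_constant a b * e ^+ 2.
have C0 : 0 <= C by rewrite mulr_ge0 ?sqr_ge0// contraction_constant_ge0//; lra.
have Pb : carried_by (kernel_law (P s) x) `[0, b].
  apply: carried_by_kernel_law.
  apply: carried_by_sub (carried_by_itv H01 a_gt0 P_La s0 x0) _ _ => //.
  by apply: subset_itvl; rewrite bnd_simp; lra.
have Qb : carried_by (kernel_law (Q s) y) `[0, b].
  apply: carried_by_kernel_law.
  apply: carried_by_sub (carried_by_itv H01 a_gt0 Q_La s0 y0) _ _ => //.
  by apply: subset_itvl; rewrite bnd_simp; lra.
have [mb _ Pb1] := Pb; have [_ _ Qb1] := Qb.
have c0 := expR_gt0 (- (rate * e)).
have c1 : expR (- (rate * e)) <= 1.
  by rewrite -[leRHS]expR0 ler_expR oppr_le0 mulr_ge0 ?rate_ge0// ltW.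
have := @tail_distance_mixture _ (P e) (Q e) (kernel_law (P s) x) (kernel_law (Q s) y)
  (kernel_law (P (s + e)) x) (kernel_law (Q (s + e)) y) _ (expR (- (rate * e))) C
  mb Pb1 Qb1 c0 C0.
have CKP (B : set R) : measurable B ->
    kernel_law (P (s + e)) x B = (\int[kernel_law (P s) x]_z P e z B)%E.
  by move=> mB; case: P_La => -[_ _ +] _; apply => //; exact: ltW.
have CKQ (B : set R) : measurable B ->
    kernel_law (Q (s + e)) y B = (\int[kernel_law (Q s) y]_z Q e z B)%E.
  by move=> mB; case: Q_La => -[_ _ +] _; apply => //; exact: ltW.
move=> /(_ CKP CKQ) h; apply: le_trans (h _) _.
  move=> z z' /=; rewrite !in_itv/= => zb zb'.
  exact: short_time_tail_contraction.
have Ws : (W1 (kernel_law (P s) x) (kernel_law (Q s) y) <=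
    (expR (- (rate * s)) * `|x - y| + n.+1%:R * C)%:E)%E.
  apply: le_trans (W1_le_tail_distance _ _) (IH st).
    by apply: carried_by_sub Pb _ _ => //; apply: subset_itvl; rewrite bnd_simp.
  by apply: carried_by_sub Qb _ _ => //; apply: subset_itvl; rewrite bnd_simp.
apply: le_trans (leeD2r _ (lee_wpmul2l _ Ws)) _; first by rewrite lee_fin ltW.
rewrite -EFinM -EFinD lee_fin mulrDr mulrA -expRD.
rewrite (_ : - (rate * e) + - (rate * s) = - (rate * (s + e))); last by ring.
rewrite -addrA lerD2l -[n.+2]addn1 natrD mulrDl mul1r lerD2r.
by rewrite ler_piMl// mulr_ge0.
Qed.

Lemma tail_contraction t x y : 0 < t -> 0 <= x -> 0 <= y ->
  (tail_distance (kernel_law (P t) x) (kernel_law (Q t) y) <=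
   (expR (- (rate * t)) * `|x - y|)%:E)%E.
Proof.
move=> t0 x0 y0; apply/lee_addgt0Pr => d d0; have a0 := a_gt0.
pose b := x + y + 3 * t; have b0 : 0 <= b by rewrite /b; lra.
set C := contraction_constant a b.
have C0 : 0 <= C by exact: contraction_constant_ge0.
(* The three summands ensure, in turn, total error at most [d], [e <= 1] and [e * (b + a) <= 1]. *)
pose M := C * t ^+ 2 / d + t + t * (b + a).
have Cd : 0 <= C * t ^+ 2 / d by rewrite divr_ge0 ?mulr_ge0 ?sqr_ge0// ltW.
have tb : 0 <= t * (b + a) by rewrite mulr_ge0//; lra.
have [n Mn] : exists n : nat, M <= n.+1%:R.
  by exists (Num.trunc M); apply: ltW; exact: truncnS_gt.
have n0 : 0 < n.+1%:R :> R by rewrite ltr0n.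
pose e := t / n.+1%:R.
have ne : n.+1%:R * e = t by rewrite /e; field; rewrite gt_eqF.
have := @iterated_tail_contraction b t x y e n x0 y0; rewrite ne -/C => h.
apply: le_trans (h _ _ _ _ _ _) _ => //.
- by rewrite /b; lra.
- by rewrite /b; lra.
- by rewrite divr_gt0.
- by rewrite /e ler_pdivrMr// mul1r; apply: le_trans Mn; rewrite /M; lra.
- rewrite /e mulrAC ler_pdivrMr// mul1r; apply: le_trans Mn; rewrite /M; lra.
rewrite -EFinD lee_fin lerD2l.
rewrite (_ : _ * _ = C * t ^+ 2 / n.+1%:R); last by rewrite /e; field; rewrite gt_eqF.
rewrite ler_pdivrMr// [d * _]mulrC -ler_pdivrMr//.
by apply: le_trans Mn; rewrite /M; lra.
Qed.

Lemma W1_contraction (alpha beta alpha' beta' : probability R R) t :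
  0 < t -> alpha `[0, +oo[%classic = 1%E -> beta `[0, +oo[%classic = 1%E ->
  alpha' `[0, +oo[%classic = 1%E -> beta' `[0, +oo[%classic = 1%E ->
  (forall B : set R, measurable B -> alpha' B = (\int[alpha]_y P t y B)%E) ->
  (forall B : set R, measurable B -> beta' B = (\int[beta]_y Q t y B)%E) ->
  (W1 alpha' beta' <= (expR (- (rate * t)))%:E * W1 alpha beta)%E.
Proof.
move=> t0 al be al' be' alphaP betaQ.
have mI : measurable (`[0, +oo[%classic : set R) by exact: measurable_itv.
apply: le_trans (W1_le_tail_distance _ _) _.
- by split => //; exact: probability_setT.
- by split => //; exact: probability_setT.
rewrite -[leRHS]adde0.
apply: (tail_distance_mixture mI al be (expR_gt0 _) (lexx 0) alphaP betaQ).
move=> y y' /=; rewrite !in_itv/= !andbT addr0 => y0 y0'.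
exact: tail_contraction.
Qed.

End contraction.

(** * One-dimensional laws of a process *)

Section process_laws.
Context (R : realType) (d : measure_display) (T : measurableType d).
Context (Pr : probability T R) (X : R -> {RV Pr >-> R}) (P : R -> R.-pker R ~> R).
Hypothesis XP : markov_process X P.

Lemma distribution_ge0 t : 0 <= t ->
  distribution Pr (X t) `[0, +oo[%classic = 1%E.
Proof.
move=> t0; rewrite -(probability_setT Pr); congr (Pr _).
apply/seteqP; split => // w _ /=; rewrite in_itv/= andbT.
by case: XP => + _; apply.
Qed.

Lemma distribution_markov t (B : set R) : 0 <= t -> measurable B ->
  distribution Pr (X t) B = (\int[distribution Pr (X 0)]_y P t y B)%E.
Proof.
move=> t0 mB; rewrite ge0_integral_distribution//; last exact: measurable_kernel.
(* The Markov property at time 0 on the full event, which belongs to the past as to any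
   sigma-algebra. *)
case: XP => _ /(_ 0 t setT B (lexx 0) t0 _ mB); rewrite subr0 setTI; apply.
exact: (@measurableT _ (g_sigma_algebraType [set A | exists (r : R) (B : set R),
  [/\ 0 <= r, r <= 0, measurable B & A = X r @^-1` B]])).
Qed.

End process_laws.

Theorem theorem2p3 (R : realType) (H : probability R R)
    (a : R) (H01 : H `[0, 1[ = 1%E) (a_gt0 : 0 < a) :
  (forall (d d' : measure_display)
          (T : measurableType d) (T' : measurableType d')
          (Pr : probability T R) (Pr' : probability T' R)
          (X : R -> {RV Pr >-> R}) (Y : R -> {RV Pr' >-> R}),
     process_La H a X -> process_La H a Y ->
     Pr.-integrable setT (EFin \o X 0) -> Pr'.-integrable setT (EFin \o Y 0) ->
     forall t : R, 0 < t ->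
       (W1 (distribution Pr (X t)) (distribution Pr' (Y t)) <=
        (expR (- (a * kappa1 H * t)))%:E *
          W1 (distribution Pr (X 0%R)) (distribution Pr' (Y 0%R)))%E) /\
  (forall (d : measure_display) (T : measurableType d) (Pr : probability T R)
          (X : R -> {RV Pr >-> R}) (mu : probability R R),
     process_La H a X -> Pr.-integrable setT (EFin \o X 0) ->
     invariant_La H a mu ->
     forall t : R, 0 <= t ->
       (W1 (distribution Pr (X t)) mu <=
        (expR (- (a * kappa1 H * t)))%:E * W1 (distribution Pr (X 0%R)) mu)%E).
Proof.
split.
  move=> d d' T T' Pr Pr' X Y [P PL XP] [Q QL YQ] _ _ t t0.
  apply: (W1_contraction H01 a_gt0 PL QL t0).
  - exact: distribution_ge0 XP _ (lexx 0).
  - exact: distribution_ge0 YQ _ (lexx 0).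
  - exact: distribution_ge0 XP _ (ltW t0).
  - exact: distribution_ge0 YQ _ (ltW t0).
  - by move=> B; exact: distribution_markov XP _ _ (ltW t0).
  - by move=> B; exact: distribution_markov YQ _ _ (ltW t0).
move=> d T Pr X mu [P PL XP] _ [mu0 [Q QL muQ]] t.
rewrite le_eqVlt => /predU1P[<-|t0].
  by rewrite mulr0 oppr0 expR0 mul1e.
(* [mu] serves as initial law and, by invariance, as law at time [t], for a semigroup [Q] that may
   differ from [P]. *)
apply: (W1_contraction H01 a_gt0 PL QL t0) => //.
- exact: distribution_ge0 XP _ (lexx 0).
- exact: distribution_ge0 XP _ (ltW t0).
- by move=> B; exact: distribution_markov XP _ _ (ltW t0).
- by move=> B mB; rewrite muQ// ltW.
Qed.
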